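(* Let $(X,x)\subset(\mathbb{C}^n,x)$, $(Y,y)\subset(\mathbb{C}^m,y)$ and $(Z,z)\subset(\mathbb{C}^l,z)$ be germs of complex analytic spaces, with morphisms $\alpha:(Z,z)\to(X,x)$ and $\beta:(Z,z)\to(Y,y)$ whose induced homomorphisms $\alpha_z^*:\mathcal{O}_{X,x}\to\mathcal{O}_{Z,z}$ and $\beta_z^*:\mathcal{O}_{Y,y}\to\mathcal{O}_{Z,z}$ are surjective and not isomorphisms. Let $(W,w)$ be a subspace of $(Y,y)$. Suppose that the gluing $(\mathcal{V},v)=(X,x)\sqcup_{(Z,z)}(Y,y)$ satisfies one of the following conditions: (a) it is weakly large and there is a surjective map $\mathcal{O}_{Y,y}\twoheadrightarrow\mathcal{O}_{X,x}$; or (b) it is strongly large. Then: (i) $\beta_0^{(\mathcal{V},v)}(W,w)=\beta_0^{(Y,y)}(W,w)$. (ii) $\beta_1^{(\mathcal{V},v)}(W,w)=\beta_0^{(Y,y)}(W,w)\,\beta_1^{(X,x)}(Z,z)+\beta_1^{(Y,y)}(W,w)$. (iii) $\beta_2^{(\mathcal{V},v)}(W,w)=\beta_0^{(Y,y)}(W,w)\,\beta_1^{(Y,y)}(Z,z)\,\beta_1^{(X,x)}(Z,z)+\beta_0^{(Y,y)}(W,w)\,\beta_2^{(X,x)}(Z,z)+\beta_1^{(Y,y)}(W,w)\,\beta_1^{(X,x)}(Z,z)+\beta_2^{(Y,y)}(W,w)$.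
   Context: Germs: for a germ $(X,x)\subset(\mathbb{C}^n,x)$ of a complex analytic space, $\mathcal{O}_{X,x}\cong\mathcal{O}_{\mathbb{C}^n,x}/\mathcal{I}_{X,x}$ where $\mathcal{I}_{X,x}$ is the ideal of all germs of holomorphic functions vanishing on $X$; it is a reduced Noetherian local analytic $\mathbb{C}$-algebra with residue field $\mathbb{C}$. A subspace $(W,w)$ of $(X,x)$ is one defined by a reduced (i.e. radical) ideal $I\subset\mathcal{O}_{X,x}$, with local ring $\mathcal{O}_{X,x}/I$. Betti numbers and Poincaré series: for a finitely generated $\mathcal{O}_{X,x}$-module $M$, $\beta_i^{\mathcal{O}_{X,x}}(M)=\dim_{\mathbb{C}}\mathrm{Tor}_i^{\mathcal{O}_{X,x}}(M,\mathbb{C})$ and $P^{\mathcal{O}_{X,x}}_M(t)=\sum_{i\ge0}\beta_i^{\mathcal{O}_{X,x}}(M)t^i$. For a subspace $(W,w)$ defined by $I$, $\beta_i^{(X,x)}(W,w):=\beta_i^{\mathcal{O}_{X,x}}(\mathcal{O}_{X,x}/I)$ and $P^{(X,x)}_{(W,w)}(t):=P^{\mathcal{O}_{X,x}}_{\mathcal{O}_{X,x}/I}(t)$. Gluing: $(\mathcal{V},v)=(X,x)\sqcup_{(Z,z)}(Y,y)$ is the pushout of $\alpha:(Z,z)\to(X,x)$ and $\beta:(Z,z)\to(Y,y)$, with canonical morphisms $f:(X,x)\to(\mathcal{V},v)$ and $g:(Y,y)\to(\mathcal{V},v)$. Its local ring is the fiber product $\mathcal{O}_{\mathcal{V},v}=\{(s,t)\in\mathcal{O}_{X,x}\times\mathcal{O}_{Y,y}:\alpha_z^*(s)=\beta_z^*(t)\}$,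 a Noetherian local analytic $\mathbb{C}$-algebra, and $f,g$ correspond to the surjective projections $\pi_1:\mathcal{O}_{\mathcal{V},v}\to\mathcal{O}_{X,x}$ and $\pi_2:\mathcal{O}_{\mathcal{V},v}\to\mathcal{O}_{Y,y}$. Through $\pi_1$ (resp. $\pi_2$), $\mathcal{O}_{X,x}$-modules (resp. $\mathcal{O}_{Y,y}$-modules) are $\mathcal{O}_{\mathcal{V},v}$-modules, and subspaces of $(X,x)$ (resp. $(Y,y)$) are regarded as subspaces of $(\mathcal{V},v)$. $(Z,z)$ is regarded as a subspace of $(X,x)$ and of $(Y,y)$ via $\alpha_z^*$ and $\beta_z^*$. Large morphism: a morphism $h:(Y',y')\to(X',x')$ of germs with $\mathcal{O}_{X',x'}\to\mathcal{O}_{Y',y'}$ surjective is large if for every subspace $(W,w)$ of $(Y',y')$, regarded as a subspace of $(X',x')$, one has $P^{(X',x')}_{(W,w)}=P^{(Y',y')}_{(W,w)}P^{(X',x')}_{(Y',y')}$. Weakly large gluing: $P^{\mathcal{O}_{\mathcal{V},v}}_{K}(t)=P^{\mathcal{O}_{X,x}}_{K}(t)\,P^{(\mathcal{V},v)}_{(X,x)}(t)$, where $K=\ker(\alpha_z^* )$ is viewed as an $\mathcal{O}_{X,x}$-module. Large gluing: the morphism $f$ is large. Strongly large gluing: both $f$ and $g$ are large.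
   Formalization: In condition (a) the surjective map from O_{Y,y} to O_{X,x} is required to be a C-algebra homomorphism compatible with the gluing maps (its composite with alpha_z^* equals beta_z^* ); without this compatibility the stated formulas can fail. *)

(* Defs.v *)
From HB Require Import structures.
From mathcomp Require Import all_boot all_order all_algebra.
From mathcomp Require Import complex.
From mathcomp Require Import boolp classical_sets functions filter reals topology normedtype.

Set Implicit Arguments.
Unset Strict Implicit.
Unset Printing Implicit Defensive.

Import Order.TTheory GRing.Theory Num.Theory.
Import numFieldNormedType.Exports.
Local Open Scope classical_set_scope.
Local Open Scope quotient_scope.
Local Open Scope ring_scope.
Local Open Scope complex_scope.

(* Vectors are rows, so the differential F_(i+1) -> F_i is [fun u => u *m bdry i]. *)
Record free_resolution (A : comNzRingType) (M : lmodType A) := FreeResolution {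
  rk : nat -> nat;
  bdry : forall i, 'M[A]_(rk i.+1, rk i);
  aug : {linear 'rV[A]_(rk 0) -> M};
  aug_surj : forall y, exists u, aug u = y;
  exact_aug : forall u, aug u = 0 <-> exists v, u = v *m bdry 0;
  exact_bdry : forall i (u : 'rV[A]_(rk i.+1)), u *m bdry i = 0 <-> exists v, u = v *m bdry i.+1
}.

(* [dim_k Tor_i^A(M, k)] computed from the resolution [F], where [k] is an
   [A]-module through [rho]: tensoring [F] with [k] gives the vector spaces
   k^(rk i) with differentials [map_mx rho (bdry F i)]. *)
Definition tor_dim (A : comNzRingType) (k : fieldType) (rho : {rmorphism A -> k})
    (M : lmodType A) (F : free_resolution M) (i : nat) : nat :=
  match i with
  | 0 => rk F 0 - \rank (map_mx rho (bdry F 0))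
  | j.+1 => \rank (kermx (map_mx rho (bdry F j))) -
            \rank (map_mx rho (bdry F j.+1))
  end%N.

(* [tor_dim] does not depend on the resolution, and every finitely generated
   module over a Noetherian ring has one; the value 0 is junk for the
   modules without resolution by free modules of finite rank. *)
Definition betti (A : comNzRingType) (k : fieldType) (rho : {rmorphism A -> k})
    (M : lmodType A) (i : nat) : nat :=
  xget 0%N [set b | exists F : free_resolution M, tor_dim rho F i = b].

(* Power series over [nat] are given by their coefficients. *)
Definition poincare (A : comNzRingType) (k : fieldType)
    (rho : {rmorphism A -> k}) (M : lmodType A) : nat -> nat :=
  fun i => betti rho M i.

Definition ps_mul (p q : nat -> nat) : nat -> nat :=
  fun i => (\sum_(j < i.+1) p j * q (i - j))%N.

(* Restriction of scalars of the [B]-module [M] along [phi : A -> B]. *)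
Definition restr (A B : comNzRingType) (phi : {rmorphism A -> B})
  (M : lmodType B) : Type := M.

Section Restr.
Variables (A B : comNzRingType) (phi : {rmorphism A -> B}) (M : lmodType B).
HB.instance Definition _ := GRing.Zmodule.on (restr phi M).

Definition restr_scale (a : A) (y : restr phi M) : restr phi M :=
  phi a *: (y : M).

Fact restr_scaleA a b y :
  restr_scale a (restr_scale b y) = restr_scale (a * b) y.
Proof. by rewrite /restr_scale scalerA rmorphM. Qed.
Fact restr_scale1 : left_id 1 restr_scale.
Proof. by move=> y; rewrite /restr_scale rmorph1 scale1r. Qed.
Fact restr_scaleDr : right_distributive restr_scale +%R.
Proof. by move=> a y z; rewrite /restr_scale scalerDr. Qed.
Fact restr_scaleDl y : {morph restr_scale^~ y : a b / a + b}.
Proof. by move=> a b; rewrite /restr_scale rmorphD scalerDl. Qed.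
HB.instance Definition _ := GRing.Zmodule_isLmodule.Build A (restr phi M)
  restr_scaleA restr_scale1 restr_scaleDr restr_scaleDl.
End Restr.

(* The kernel of a ring morphism, as a module over its source. *)
Section KerMod.
Variables (A B : comNzRingType) (phi : {rmorphism A -> B}).

Definition kerm_pred : {pred A^o} := fun a => phi a == 0.
Fact kerm_submod : submod_closed kerm_pred.
Proof.
split=> [|a x y]; rewrite !unfold_in /=; first by rewrite rmorph0.
by move=> /eqP x0 /eqP y0; rewrite rmorphD rmorphM x0 y0 mulr0 addr0.
Qed.
HB.instance Definition _ := GRing.isSubmodClosed.Build A A^o kerm_pred kerm_submod.

Record kerm := Kerm { kerm_val : A^o; _ : kerm_val \in kerm_pred }.
HB.instance Definition _ := [isSub for kerm_val].
HB.instance Definition _ := [Choice of kerm by <:].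
HB.instance Definition _ := [SubChoice_isSubLmodule of kerm by <:].
End KerMod.

(* Members of [idealr A] are proper, as befits subspaces through the base
   point. *)
Definition radical_ideal (A : comNzRingType) (I : idealr A) : Prop :=
  forall (a : A) (p : nat), a ^+ p \in I -> a \in I.

(* The local ring [A / I] of the subspace defined by [I], as an [A]-module. *)
Definition subsp (A : comNzRingType) (I : idealr A) : lmodType A :=
  restr (\pi_{ideal_quot I} : {rmorphism A -> {ideal_quot I}})
        ({ideal_quot I})^o.

(* [phi : A -> B] is the comorphism, [rhoA] and [rhoB] are the residue maps. *)
Definition large (A B : comNzRingType) (k : fieldType)
    (rhoA : {rmorphism A -> k}) (rhoB : {rmorphism B -> k})
    (phi : {rmorphism A -> B}) : Prop :=
  forall I : idealr B, radical_ideal I ->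
    poincare rhoA (restr phi (subsp I)) =1
    ps_mul (poincare rhoB (subsp I)) (poincare rhoA (restr phi B^o)).

Section Fiber.
Variables (A B T : comNzRingType).
Variables (a : {rmorphism A -> T}) (b : {rmorphism B -> T}).

Definition fiber_pred : {pred (A * B)%type} := fun p => a p.1 == b p.2.
Fact fiber_subring : subring_closed fiber_pred.
Proof.
split=> [|x y|x y]; rewrite !unfold_in /=; first by rewrite !rmorph1.
- by move=> /eqP hx /eqP hy; rewrite !rmorphB hx hy.
- by move=> /eqP hx /eqP hy; rewrite !rmorphM hx hy.
Qed.
HB.instance Definition _ :=
  GRing.isSubringClosed.Build (A * B)%type fiber_pred fiber_subring.

Record fiber := Fiber { fiber_val : (A * B)%type; _ : fiber_val \in fiber_pred }.
HB.instance Definition _ := [isSub for fiber_val].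
HB.instance Definition _ := [Choice of fiber by <:].
HB.instance Definition _ := [SubChoice_isSubComNzRing of fiber by <:].

Definition proj1_fun (p : fiber) : A := (fiber_val p).1.
Definition proj2_fun (p : fiber) : B := (fiber_val p).2.
Fact proj1_zmod : zmod_morphism proj1_fun. Proof. by []. Qed.
Fact proj1_monoid : monoid_morphism proj1_fun. Proof. by []. Qed.
Fact proj2_zmod : zmod_morphism proj2_fun. Proof. by []. Qed.
Fact proj2_monoid : monoid_morphism proj2_fun. Proof. by []. Qed.
HB.instance Definition _ := GRing.isZmodMorphism.Build fiber A proj1_fun proj1_zmod.
HB.instance Definition _ := GRing.isMonoidMorphism.Build fiber A proj1_fun proj1_monoid.
HB.instance Definition _ := GRing.isZmodMorphism.Build fiber B proj2_fun proj2_zmod.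
HB.instance Definition _ := GRing.isMonoidMorphism.Build fiber B proj2_fun proj2_monoid.
End Fiber.

(* Monomials are indexed by [nu : {ffun 'I_n -> nat}], and series are summed
   along the boxes [0, N[^n. *)
Section PowerSeries.
Variables (K : numFieldType) (n : nat).
Implicit Types (a : {ffun 'I_n -> nat} -> K) (h : 'rV[K]_n).

Definition midx N (nu : {ffun 'I_n -> 'I_N}) : {ffun 'I_n -> nat} :=
  [ffun i => val (nu i)].

Definition box_sum a h N : K :=
  \sum_(nu : {ffun 'I_n -> 'I_N}) a (midx nu) * \prod_(i < n) h 0 i ^+ nu i.

(* Near [x], [f] is the sum of a power series centered at [x] that converges
   absolutely on a polydisc (whose radius and bounds are nonnegative elements
   of [K], hence real).  Such a function is holomorphic near [x], and the
   germs at [x] of these functions are the germs of holomorphic functions. *)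
Definition holomorphic_at (x : 'rV[K]_n) (f : 'rV[K]_n -> K) : Prop :=
  exists (a : {ffun 'I_n -> nat} -> K) (r : K), [/\ 0 < r,
    exists M : K, forall N,
      box_sum (fun nu => `|a nu|) (const_mx r) N <= M &
    forall h, (forall i, `|h 0 i| < r) ->
      box_sum a h @ \oo --> f (x + h)].

End PowerSeries.

(* The complex field, as an abstract structure: the topology of the library is
   attached to abstract [numFieldType]s and is not found on [R[i]]. *)
Definition CC (R : realType) : numClosedFieldType := R[i].

Section PowerSeriesRing.
Variables (R : realType) (n : nat).
Local Notation K := (CC R).
Implicit Types (a b : {ffun 'I_n -> nat} -> K) (h x : 'rV[K]_n).

Let box N : seq {ffun 'I_n -> nat} :=
  [seq midx nu | nu : {ffun 'I_n -> 'I_N}].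

Let mon h (nu : {ffun 'I_n -> nat}) : K := \prod_(i < n) h 0 i ^+ nu i.

Let box_sumE a h N : box_sum a h N = \sum_(nu <- box N) a nu * mon h nu.
Proof.
rewrite big_image /=; apply: eq_bigr => nu _; congr (_ * _).
by apply: eq_bigr => i _; rewrite ffunE.
Qed.

Let mem_box N nu : (nu \in box N) = [forall i, (nu i < N)%N].
Proof.
apply/fintype.imageP/forallP => [[mu _ ->] i|h].
  by rewrite ffunE; exact: ltn_ord.
exists [ffun i => Ordinal (h i)] => //.
by apply/ffunP => i; rewrite !ffunE.
Qed.

Let box_uniq N : uniq (box N).
Proof.
rewrite map_inj_uniq ?enum_uniq // => mu nu /ffunP e; apply/ffunP => i.
by apply/val_inj; move: (e i); rewrite !ffunE.
Qed.

Let big_box_sub N N' (P : pred {ffun 'I_n -> nat}) (F : _ -> K) :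
  (N <= N')%N -> (forall nu, P nu -> nu \in box N) ->
  \sum_(nu <- box N | P nu) F nu = \sum_(nu <- box N' | P nu) F nu.
Proof.
move=> le PN; rewrite -big_filter -[RHS]big_filter; apply: perm_big.
apply: uniq_perm; rewrite ?filter_uniq // => nu; rewrite !mem_filter.
case: (boolP (P nu)) => //= /PN nuN; rewrite nuN; apply/esym.
move: nuN; rewrite !mem_box => /forallP nuN; apply/forallP => i.
exact: leq_trans (nuN i) le.
Qed.

Let madd (nu mu : {ffun 'I_n -> nat}) : {ffun 'I_n -> nat} :=
  [ffun i => (nu i + mu i)%N].

Let mdeg (nu : {ffun 'I_n -> nat}) := (\sum_i nu i)%N.

Let monD h nu mu : mon h (madd nu mu) = mon h nu * mon h mu.
Proof.
by rewrite /mon -big_split /=; apply: eq_bigr => i _; rewrite ffunE exprD.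
Qed.

Let cauchy a b (la : {ffun 'I_n -> nat}) : K :=
  \sum_(nu <- box (mdeg la).+1) \sum_(mu <- box (mdeg la).+1 | madd nu mu == la)
     a nu * b mu.

Let maddl nu mu la i : madd nu mu = la -> (nu i <= la i)%N /\ (mu i <= la i)%N.
Proof. by move=> <-; rewrite ffunE leq_addr leq_addl. Qed.

Let le_mdeg (la : {ffun 'I_n -> nat}) i : (la i <= mdeg la)%N.
Proof. by rewrite /mdeg (bigD1 i) //= leq_addr. Qed.

Let cauchyE a b N la : la \in box N ->
  cauchy a b la =
  \sum_(nu <- box N) \sum_(mu <- box N | madd nu mu == la) a nu * b mu.
Proof.
move=> laN; pose G N1 N2 := \sum_(nu <- box N1)
   \sum_(mu <- box N2 | madd nu mu == la) a nu * b mu.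
have good N1 N2 : la \in box N1 -> la \in box N2 -> (N1 <= N2)%N ->
    G N1 N1 = G N2 N2.
  move=> l1 l2 le; have le1 i : (la i < N1)%N by move: l1; rewrite mem_box => /forallP.
  have -> : G N1 N1 = G N1 N2.
    apply: eq_bigr => nu _; apply: big_box_sub => // mu /eqP e.
    rewrite mem_box; apply/forallP => i.
    exact: leq_ltn_trans (maddl i e).2 (le1 i).
  pose P nu := \big[orb/false]_(mu <- box N2) (madd nu mu == la).
  have PE nu : ~~ P nu -> \sum_(mu <- box N2 | madd nu mu == la) a nu * b mu = 0.
    rewrite /P big_has -all_predC => /allP hP.
    by rewrite big_seq_cond big1 // => mu /andP[/hP /= /negPf ->].
  rewrite /G (bigID P) /= [X in _ + X]big1 ?addr0; last by move=> nu /PE.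
  rewrite [RHS](bigID P) /= [X in _ = _ + X]big1 ?addr0; last by move=> nu /PE.
  apply: big_box_sub => // nu; rewrite /P big_has => /hasP[mu _ /eqP e].
  rewrite mem_box; apply/forallP => i.
  exact: leq_ltn_trans (maddl i e).1 (le1 i).
have laS : la \in box (mdeg la).+1.
  by rewrite mem_box; apply/forallP => i; rewrite ltnS le_mdeg.
by case: (leqP (mdeg la).+1 N) => [le|/ltnW le]; [|apply/esym]; exact: good.
Qed.

Let box_sum_cauchy a b h N : box_sum (cauchy a b) h N =
  \sum_(nu <- box N) \sum_(mu <- box N | madd nu mu \in box N)
     (a nu * mon h nu) * (b mu * mon h mu).
Proof.
rewrite box_sumE big_seq; under eq_bigr => la laN.
  rewrite (cauchyE _ _ laN) mulr_suml.
  under eq_bigr => nu _ do rewrite mulr_suml.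
  over.
rewrite -big_seq exchange_big /=; apply: eq_bigr => nu _.
rewrite (exchange_big_dep xpredT) //= [RHS]big_mkcond /=.
apply: eq_bigr => mu _; case: ifPn => hin.
  rewrite -big_filter.
  have -> : [seq la <- box N | madd nu mu == la] = [:: madd nu mu].
    rewrite -(filter_pred1_uniq (box_uniq N) hin).
    by apply: eq_filter => z /=; rewrite eq_sym.
  by rewrite big_seq1 monD mulrACA.
rewrite big_seq_cond big1 // => la /andP[laN /eqP e].
by rewrite e laN in hin.
Qed.

Let box_sumM a b h N : box_sum a h N * box_sum b h N - box_sum (cauchy a b) h N
  = \sum_(nu <- box N) \sum_(mu <- box N | madd nu mu \notin box N)
     (a nu * mon h nu) * (b mu * mon h mu).
Proof.
rewrite box_sum_cauchy !box_sumE mulr_suml -sumrB; apply: eq_bigr => nu _.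
by rewrite mulr_sumr (bigID (fun mu => madd nu mu \in box N)) /= addrAC subrr add0r.
Qed.

Let mon_norm h nu : `|mon h nu| = \prod_(i < n) `|h 0 i| ^+ nu i.
Proof. by rewrite /mon normr_prod; apply: eq_bigr => i _; rewrite normrX. Qed.

Let mon_const (r : K) nu : mon (const_mx r) nu = r ^+ mdeg nu.
Proof. by rewrite /mon /mdeg expr_sum; apply: eq_bigr => i _; rewrite mxE. Qed.

Let abs_bounded a (r : K) := exists M : K, forall N,
  box_sum (fun nu => `|a nu|) (const_mx r) N <= M.

Let abs_ge0 a (r : K) N : 0 <= r -> 0 <= box_sum (fun nu => `|a nu|) (const_mx r) N.
Proof.
move=> r0; rewrite box_sumE sumr_ge0 // => nu _.
by rewrite mon_const mulr_ge0 ?exprn_ge0.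
Qed.

Let abs_bounded_le a (r s : K) : 0 <= s -> s <= r -> abs_bounded a r -> abs_bounded a s.
Proof.
move=> s0 sr [M hM]; exists M => N; apply: le_trans (hM N).
rewrite !box_sumE; apply: ler_sum => nu _.
by rewrite !mon_const ler_wpM2l // lerXn2r // nnegrE (le_trans s0).
Qed.

Let abs_boundedM a b (r : K) : 0 <= r -> abs_bounded a r -> abs_bounded b r ->
  abs_bounded (cauchy a b) r.
Proof.
move=> r0 [Ma ha] [Mb hb]; exists (Ma * Mb) => N.
apply: (@le_trans _ _ (box_sum (cauchy (fun nu => `|a nu|) (fun nu => `|b nu|))
   (const_mx r) N)).
  rewrite !box_sumE; apply: ler_sum => la _.
  rewrite mon_const ler_wpM2r ?exprn_ge0 //.
  apply: le_trans (ler_norm_sum _ _ _) _; apply: ler_sum => nu _.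
  apply: le_trans (ler_norm_sum _ _ _) _; apply: ler_sum => mu _.
  by rewrite normrM.
apply: (@le_trans _ _ (box_sum (fun nu => `|a nu|) (const_mx r) N *
                       box_sum (fun nu => `|b nu|) (const_mx r) N)).
  rewrite -subr_ge0 box_sumM; apply: sumr_ge0 => nu _; apply: sumr_ge0 => mu _.
  by rewrite !mon_const !mulr_ge0 ?exprn_ge0.
by apply: ler_pM; rewrite ?abs_ge0.
Qed.

Let box_sumM_le a b (r : K) h N (Ma Mb : K) : 0 <= r ->
  (forall i, `|h 0 i| <= r / 2) ->
  (forall N, box_sum (fun nu => `|a nu|) (const_mx r) N <= Ma) ->
  (forall N, box_sum (fun nu => `|b nu|) (const_mx r) N <= Mb) ->
  `|box_sum a h N * box_sum b h N - box_sum (cauchy a b) h N|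
    <= (Ma * Mb) / 2 ^+ N.
Proof.
move=> r0 hr ha hb; rewrite box_sumM.
apply: (@le_trans _ _ ((box_sum (fun nu => `|a nu|) (const_mx r) N *
                       box_sum (fun nu => `|b nu|) (const_mx r) N) / 2 ^+ N)); last first.
  by rewrite ler_wpM2r ?invr_ge0 ?exprn_ge0 // ler_pM ?abs_ge0.
rewrite !box_sumE mulr_suml mulr_suml.
apply: le_trans (ler_norm_sum _ _ _) _; apply: ler_sum => nu _.
rewrite mulr_sumr mulr_suml.
apply: le_trans (ler_norm_sum _ _ _) _; rewrite big_mkcond; apply: ler_sum => mu _.
have mon_le : `|mon h (madd nu mu)| <= (r / 2) ^+ mdeg (madd nu mu).
  rewrite mon_norm /mdeg expr_sum; apply: ler_prod => i _.
  by rewrite exprn_ge0 // lerXn2r ?nnegrE ?divr_ge0.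
have mdegD : mdeg (madd nu mu) = (mdeg nu + mdeg mu)%N.
  by rewrite /mdeg -big_split; apply: eq_bigr => i _; rewrite ffunE.
case: ifPn => [hN|_]; last first.
  by rewrite !mulr_ge0 ?invr_ge0 ?exprn_ge0 // mon_const exprn_ge0.
rewrite mulrACA -monD normrM normrM [leRHS](_ : _ = `|a nu| * `|b mu| *
    (r ^+ mdeg (madd nu mu) / 2 ^+ N)); last first.
  by rewrite !mon_const mdegD exprD [RHS]mulrA mulrACA.
rewrite ler_wpM2l ?mulr_ge0 //; apply: le_trans mon_le _.
rewrite expr_div_n ler_wpM2l ?exprn_ge0 // lef_pV2 ?posrE ?exprn_gt0 //.
rewrite ler_weXn2l ?ler1n //.
rewrite mem_box in hN; case/forallPn: hN => i; rewrite -leqNgt => hi.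
exact: leq_trans hi (le_mdeg _ _).
Qed.

Let archi_pow2 (M e : K) : 0 <= M -> 0 < e ->
  exists N0, forall N, (N0 <= N)%N -> M < e * 2 ^+ N.
Proof.
case: M e => [m m'] [e e']; rewrite lecE ltcE /= => /andP[/eqP -> m0] /andP[/eqP -> e0].
exists (Num.bound (e^-1 * m)) => N hN.
have -> : (e +i* 0) * 2 ^+ N = (e * 2 ^+ N)%:C :> R[i].
  by rewrite rmorphM rmorphXn /= rmorph_nat.
rewrite ltcR -ltr_pdivrMl //.
apply: lt_le_trans (archi_boundP _) _; first by rewrite mulr_ge0 ?invr_ge0 // ltW.
rewrite -natrX ler_nat; apply: leq_trans hN _.
by rewrite ltnW // ltn_expl.
Qed.

Let geo_cvg0 (M : K) : 0 <= M -> (fun N => M / 2 ^+ N) @ \oo --> (0 : K).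
Proof.
move=> M0; apply/cvgr0Pnorm_lt => e e0; have [N0 hN0] := archi_pow2 M0 e0.
exists N0 => // N /= hN.
rewrite ger0_norm ?divr_ge0 ?exprn_ge0 // ltr_pdivrMr ?exprn_gt0 //.
exact: hN0.
Qed.

Let common_radius (r s : K) : 0 < r -> 0 < s ->
  exists t : K, [/\ 0 < t, t <= r & t <= s].
Proof.
move=> r0 s0; exists (r * s / (r + s)).
have rs0 : 0 < r + s by rewrite addr_gt0.
rewrite divr_gt0 ?mulr_gt0 //; split=> //; rewrite ler_pdivrMr //.
  by rewrite ler_wpM2l ?ler_wpDl // ltW.
by rewrite mulrC ler_wpM2l ?ler_wpDr // ltW.
Qed.

Lemma holomorphic_at_cst x (c : K) : holomorphic_at x (cst c).
Proof.
pose a nu : K := if nu == [ffun=> 0%N] :> {ffun 'I_n -> nat} then c else 0.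
have sumE (F : K -> K) h N : F 0 = 0 ->
    box_sum (fun nu => F (a nu)) h N.+1 = F c.
  move=> F0; rewrite box_sumE (bigD1_seq [ffun=> 0%N]) ?box_uniq //=; last first.
    by rewrite mem_box; apply/forallP => i; rewrite ffunE.
  rewrite /a eqxx big1 ?addr0 => [|nu /negPf ->]; last by rewrite F0 mul0r.
  rewrite /mon big1 ?mulr1 // => i _; by rewrite ffunE expr0.
exists a, 1; split; first exact: ltr01.
  exists (`|c| + box_sum (fun nu => `|a nu|) (const_mx 1) 0) => -[|N].
    by rewrite lerDr.
  by rewrite (sumE (fun z => `|z|)) ?normr0 // lerDl abs_ge0.
move=> h _; apply: cvg_near_cst; exists 1%N => // -[|N] //= _.
exact: (sumE id).
Qed.

Lemma holomorphic_atB x f g : holomorphic_at x f -> holomorphic_at x g ->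
  holomorphic_at x (f - g).
Proof.
move=> [a [r [r0 abr af]]] [b [s [s0 abs bg]]].
have [t [t0 tr ts]] := common_radius r0 s0.
exists (fun nu => a nu - b nu), t; split; first exact: t0.
  have [Ma ha] := abs_bounded_le (ltW t0) tr abr.
  have [Mb hb] := abs_bounded_le (ltW t0) ts abs.
  exists (Ma + Mb) => N; apply: le_trans (lerD (ha N) (hb N)).
  rewrite !box_sumE -big_split /=; apply: ler_sum => nu _.
  rewrite -mulrDl mon_const ler_wpM2r ?exprn_ge0 ?(ltW t0) //; exact: ler_normB.
move=> h hh.
rewrite (_ : box_sum _ h = (fun N => box_sum a h N - box_sum b h N)); last first.
  apply/funext => N; rewrite !box_sumE -sumrB; apply: eq_bigr => nu _.
  by rewrite mulrBl.
apply: cvgB; [apply: af | apply: bg] => i; exact: lt_le_trans (hh i) _.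
Qed.

Lemma holomorphic_atM x f g : holomorphic_at x f -> holomorphic_at x g ->
  holomorphic_at x (f * g).
Proof.
move=> [a [r [r0 abr af]]] [b [s [s0 abs bg]]].
have [t [t0 tr ts]] := common_radius r0 s0.
have abt := abs_bounded_le (ltW t0) tr abr.
have bbt := abs_bounded_le (ltW t0) ts abs.
have t20 : 0 < t / 2 by rewrite divr_gt0.
have t2t : t / 2 <= t by rewrite ler_pdivrMr // ler_peMr ?(ltW t0) // ler1n.
exists (cauchy a b), (t / 2); split; first exact: t20.
  apply: (abs_bounded_le (ltW t20) t2t); exact: abs_boundedM (ltW t0) abt bbt.
move=> h hh; have ht i : `|h 0 i| < t by exact: lt_le_trans (hh i) _.
have [Ma ha] := abt; have [Mb hb] := bbt.
pose D N := box_sum a h N * box_sum b h N - box_sum (cauchy a b) h N.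
have D0 : D @ \oo --> (0 : K).
  apply/cvgr0Pnorm_lt => e e0.
  have Mab0 : 0 <= Ma * Mb.
    apply: mulr_ge0.
      exact: le_trans (abs_ge0 a 0 (ltW t0)) (ha 0%N).
    exact: le_trans (abs_ge0 b 0 (ltW t0)) (hb 0%N).
  have /cvgr0Pnorm_lt /(_ e e0) := geo_cvg0 Mab0.
  apply: filterS => N; rewrite ger0_norm ?divr_ge0 ?exprn_ge0 //.
  apply: le_lt_trans.
  exact: (box_sumM_le N (ltW t0) (fun i => ltW (hh i)) ha hb).
rewrite (_ : box_sum (cauchy a b) h =
    (fun N => box_sum a h N * box_sum b h N - D N)); last first.
  by apply/funext => N; rewrite /D opprB addrC subrK.
rewrite (_ : (f * g) (x + h) = f (x + h) * g (x + h) - 0); last by rewrite subr0.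
apply: cvgB; last exact: D0.
by apply: cvgM; [apply: af | apply: bg] => i; exact: lt_le_trans (ht i) _.
Qed.

End PowerSeriesRing.

(* Functions holomorphic at [x]; their germs are taken at the next stage, the
   ideal of a germ of analytic space containing the functions vanishing
   near [x]. *)
Section HolomorphicFunctions.
Variables (R : realType) (n : nat) (x : 'rV[CC R]_n).

Definition holo_pred : {pred 'rV[CC R]_n -> CC R} :=
  fun f => `[< holomorphic_at x f >].
Fact holo_subring : subring_closed holo_pred.
Proof.
split=> [|f g /asboolP hf /asboolP hg|f g /asboolP hf /asboolP hg]; apply/asboolP.
- exact: holomorphic_at_cst.
- exact: holomorphic_atB.
- exact: holomorphic_atM.
Qed.
HB.instance Definition _ :=
  GRing.isSubringClosed.Build ('rV[CC R]_n -> CC R) holo_pred holo_subring.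

Record holofun :=
  Holofun { holofun_val :> 'rV[CC R]_n -> CC R; _ : holofun_val \in holo_pred }.
HB.instance Definition _ := [isSub for holofun_val].
HB.instance Definition _ := [Choice of holofun by <:].
HB.instance Definition _ := [SubChoice_isSubComNzRing of holofun by <:].

Definition mk_holofun f (hf : holomorphic_at x f) : holofun :=
  Holofun (introT (asboolP _) hf).

Lemma holofunP (f : holofun) : holomorphic_at x f.
Proof. by case: f => f hf; exact/asboolP. Qed.
End HolomorphicFunctions.

(* The germ at [base] of the closed analytic subset [locus]. *)
Record germ (R : realType) (n : nat) := Germ {
  base : 'rV[CC R]_n;
  locus : set 'rV[CC R]_n;
  base_locus : locus base;
  locus_analytic : exists (k : nat) (f : 'I_k -> 'rV[CC R]_n -> CC R),
    (forall j, holomorphic_at base (f j)) /\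
    \forall y \near base, locus y <-> (forall j, f j y = 0)
}.

Section LocalRing.
Variables (R : realType) (n : nat) (X : germ R n).

Definition vanishing : holofun (base X) -> bool :=
  fun f => `[< \forall y \near base X, locus X y -> f y = 0 >].
Fact vanishing_ideal : idealr_closed vanishing.
Proof.
split.
- by apply/asboolP; apply: filterE.
- apply/negP => /asboolP /nbhs_singleton /(_ (base_locus X)) /eqP.
  by rewrite oner_eq0.
- move=> a f g /asboolP hf /asboolP hg; apply/asboolP.
  near=> y => Xy.
  have f0 : f y = 0 by move: Xy; near: y.
  have g0 : g y = 0 by move: Xy; near: y.
  rewrite [LHS](_ : _ = a y * f y + g y) //.
  by rewrite f0 g0 mulr0 addr0.
Unshelve. all: by end_near.
Qed.
HB.instance Definition _ := isIdealr.Build (holofun (base X)) vanishing vanishing_ideal.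
Definition vanishing_idealr : idealr (holofun (base X)) := vanishing.

Definition local_ring : comNzRingType := {ideal_quot vanishing_idealr}.

Definition germ_of (f : holofun (base X)) : local_ring :=
  \pi_({ideal_quot vanishing_idealr}) f.

Lemma germ_of_repr (s : local_ring) : germ_of (repr s) = s.
Proof. exact: reprK. Qed.

Lemma germ_ofP f g : germ_of f = germ_of g <->
  \forall y \near base X, locus X y -> f y = g y.
Proof.
have -> : (germ_of f = germ_of g) <-> f - g \in vanishing_idealr.
  by rewrite Quotient.idealrBE; split=> [|/eqP] e; [exact/eqP|].
split=> [/asboolP|] h; [|apply/asboolP]; apply: filterS h => y h Xy.
  by apply/eqP; rewrite -subr_eq0; apply/eqP; exact: h.
by rewrite [LHS](_ : _ = f y - g y) // h // subrr.
Qed.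

Definition cst_germ (c : CC R) : local_ring :=
  germ_of (mk_holofun (holomorphic_at_cst (base X) c)).

(* The residue map O_(X,x) -> C, evaluation at the base point. *)
Definition residue_fun (s : local_ring) : CC R := (repr s : holofun _) (base X).

Lemma residue_germ_of f : residue_fun (germ_of f) = f (base X).
Proof.
have /germ_ofP/nbhs_singleton : germ_of (repr (germ_of f)) = germ_of f.
  exact: germ_of_repr.
by apply; exact: base_locus.
Qed.

Fact residue_zmod : zmod_morphism residue_fun.
Proof.
move=> s t; rewrite -[s]germ_of_repr -[t]germ_of_repr.
rewrite (_ : germ_of _ - germ_of _ = germ_of (repr s - repr t)); last first.
  by rewrite /germ_of rmorphB.
by rewrite !residue_germ_of.
Qed.
Fact residue_monoid : monoid_morphism residue_fun.
Proof.
split=> [|s t].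
  rewrite (_ : 1 = germ_of 1); first by rewrite residue_germ_of.
  by rewrite /germ_of rmorph1.
rewrite -[s]germ_of_repr -[t]germ_of_repr.
rewrite (_ : germ_of _ * germ_of _ = germ_of (repr s * repr t)); last first.
  by rewrite /germ_of rmorphM.
by rewrite !residue_germ_of.
Qed.
HB.instance Definition _ :=
  GRing.isZmodMorphism.Build local_ring (CC R) residue_fun residue_zmod.
HB.instance Definition _ :=
  GRing.isMonoidMorphism.Build local_ring (CC R) residue_fun residue_monoid.
Definition residue : {rmorphism local_ring -> CC R} := residue_fun.
End LocalRing.
Arguments germ_of {R n} X f.
Arguments cst_germ {R n} X c.

(* A morphism of reduced spaces: a continuous map pulling holomorphic germs
   back to holomorphic germs.  Only the restriction of [mor] to [locus Z] near
   [base Z] matters. *)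
Record germ_morphism (R : realType) (l n : nat) (Z : germ R l) (X : germ R n) :=
  GermMorphism {
  mor :> 'rV[CC R]_l -> 'rV[CC R]_n;
  mor_base : mor (base Z) = base X;
  mor_locus : \forall y \near base Z, locus Z y -> locus X (mor y);
  mor_cont : mor y @[y --> within (locus Z) (nbhs (base Z))] --> base X;
  mor_holo : forall h, holomorphic_at (base X) h ->
    exists2 g, holomorphic_at (base Z) g &
      \forall y \near base Z, locus Z y -> h (mor y) = g y
}.

Section Pullback.
Variables (R : realType) (l n : nat) (Z : germ R l) (X : germ R n).
Variable alpha : germ_morphism Z X.

Fact mor_holofun (f : holofun (base X)) : exists g : holofun (base Z),
  \forall y \near base Z, locus Z y -> f (alpha y) = g y.
Proof.
by have [g hg fg] := mor_holo alpha (holofunP f); exists (mk_holofun hg).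
Qed.

(* The induced homomorphism O_(X,x) -> O_(Z,z), composition with [alpha]. *)
Definition pullback_fun (s : local_ring X) : local_ring Z :=
  germ_of Z (projT1 (cid (mor_holofun (repr s)))).

Lemma pullback_germ_of (f : holofun (base X)) (g : holofun (base Z)) :
  (\forall y \near base Z, locus Z y -> f (alpha y) = g y) ->
  pullback_fun (germ_of X f) = germ_of Z g.
Proof.
move=> fg; rewrite /pullback_fun; case: cid => g' /= fg'; apply/germ_ofP.
have /germ_ofP e : germ_of X (repr (germ_of X f)) = germ_of X f.
  exact: germ_of_repr.
have {}e := mor_cont alpha e.
near=> y => Zy.
have Xy : locus X (alpha y) by move: Zy; near: y; exact: mor_locus.
transitivity (f (alpha y)); last by move: Zy; near: y.
transitivity ((repr (germ_of X f) : holofun _) (alpha y)).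
  by apply/esym; move: Zy; near: y.
by move: Xy; move: Zy; near: y; exact: e.
Unshelve. all: by end_near.
Qed.

Lemma pullbackE (s : local_ring X) : exists (f : holofun (base X)) g,
  [/\ s = germ_of X f, pullback_fun s = germ_of Z g &
      \forall y \near base Z, locus Z y -> f (alpha y) = g y].
Proof.
have [g fg] := mor_holofun (repr s); exists (repr s), g.
split; [by rewrite germ_of_repr | | exact: fg].
by rewrite -(pullback_germ_of fg) germ_of_repr.
Qed.

Fact pullback_zmod : zmod_morphism pullback_fun.
Proof.
move=> s t; have [f [g [-> -> fg]]] := pullbackE s.
have [f' [g' [-> -> fg']]] := pullbackE t.
rewrite (_ : germ_of X _ - germ_of X _ = germ_of X (f - f')); last first.
  by rewrite /germ_of rmorphB.
rewrite (_ : germ_of Z _ - germ_of Z _ = germ_of Z (g - g')); last first.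
  by rewrite /germ_of rmorphB.
apply: pullback_germ_of; near=> y => Zy.
rewrite [LHS](_ : _ = f (alpha y) - f' (alpha y)) //.
rewrite [RHS](_ : _ = g y - g' y) //.
by congr (_ - _); move: Zy; near: y.
Unshelve. all: by end_near.
Qed.
Fact pullback_monoid : monoid_morphism pullback_fun.
Proof.
split=> [|s t].
  rewrite (_ : 1 = germ_of X 1); last by rewrite /germ_of rmorph1.
  rewrite (@pullback_germ_of _ 1); first by rewrite /germ_of rmorph1.
  exact: filterE.
have [f [g [-> -> fg]]] := pullbackE s.
have [f' [g' [-> -> fg']]] := pullbackE t.
rewrite (_ : germ_of X _ * germ_of X _ = germ_of X (f * f')); last first.
  by rewrite /germ_of rmorphM.
rewrite (_ : germ_of Z _ * germ_of Z _ = germ_of Z (g * g')); last first.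
  by rewrite /germ_of rmorphM.
apply: pullback_germ_of; near=> y => Zy.
rewrite [LHS](_ : _ = f (alpha y) * f' (alpha y)) //.
rewrite [RHS](_ : _ = g y * g' y) //.
by congr (_ * _); move: Zy; near: y.
Unshelve. all: by end_near.
Qed.
HB.instance Definition _ := GRing.isZmodMorphism.Build
  (local_ring X) (local_ring Z) pullback_fun pullback_zmod.
HB.instance Definition _ := GRing.isMonoidMorphism.Build
  (local_ring X) (local_ring Z) pullback_fun pullback_monoid.
Definition pullback : {rmorphism local_ring X -> local_ring Z} := pullback_fun.
End Pullback.

(* beta_i^(X,x)(W,w), for the subspace (W,w) of (X,x) defined by [I]. *)
Definition betti_subspace (R : realType) (n : nat) (X : germ R n)
    (I : idealr (local_ring X)) (i : nat) : nat :=
  betti (residue X) (subsp I) i.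

(* beta_i^(X,x)(Z,z), with (Z,z) viewed in (X,x) through [alpha]. *)
Definition betti_along (R : realType) (l n : nat) (Z : germ R l)
    (X : germ R n) (alpha : germ_morphism Z X) (i : nat) : nat :=
  betti (residue X) (restr (pullback alpha) (local_ring Z)^o) i.

Section Gluing.
Variables (R : realType) (n m l : nat).
Variables (X : germ R n) (Y : germ R m) (Z : germ R l).
Variables (alpha : germ_morphism Z X) (beta : germ_morphism Z Y).

(* The local ring of the pushout of X and Y along Z is the fiber product of
   the local rings. *)
Definition glue_ring : comNzRingType := fiber (pullback alpha) (pullback beta).

Definition pi1 : {rmorphism glue_ring -> local_ring X} :=
  @proj1_fun _ _ _ (pullback alpha) (pullback beta).
Definition pi2 : {rmorphism glue_ring -> local_ring Y} :=
  @proj2_fun _ _ _ (pullback alpha) (pullback beta).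

Definition glue_residue : {rmorphism glue_ring -> CC R} := residue X \o pi1.

Definition weakly_large_gluing : Prop :=
  poincare glue_residue (restr pi1 (kerm (pullback alpha))) =1
  ps_mul (poincare (residue X) (kerm (pullback alpha)))
         (poincare glue_residue (restr pi1 (local_ring X)^o)).

Definition strongly_large_gluing : Prop :=
  large glue_residue (residue X) pi1 /\ large glue_residue (residue Y) pi2.

(* beta_i^(V,v)(W,w), for the subspace (W,w) of (Y,y) defined by [I]. *)
Definition glue_betti (I : idealr (local_ring Y)) (i : nat) : nat :=
  betti glue_residue (restr pi2 (subsp I)) i.

End Gluing.

(* Main.v *)
From HB Require Import structures.
Require Import Defs.
From mathcomp Require Import all_boot all_order all_algebra.
From mathcomp Require Import reals.
From mathcomp Require Import complex.
From mathcomp Require Import boolp classical_sets filter topology normedtype.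
From mathcomp Require Import zify ring.

(* With K and J the kernels of the maps from A = O_X and B = O_Y onto O_Z, the
   local ring V of the gluing is the fiber product of A and B, and K and J embed
   in V with zero intersection.  Hence K is the first syzygy of B over V, J that
   of A, and K (+) J that of O_Z; comparing with the syzygies over A, either
   largeness of f at the subspace Z or weak largeness gives
   beta_1^V(K) = beta_0^A(K) beta_0^B(J) + beta_1^A(K), so that the first three
   Betti numbers of B over V are 1, beta_1^A(O_Z) and
   beta_1^B(O_Z) beta_1^A(O_Z) + beta_2^A(O_Z).  It remains to see that
   P^V_W = P^B_W P^V_B up to degree 2.  This is the largeness of g in case (b);
   in case (a) the surjection from B to A gives a section of V -> B, which lets a
   B-resolution F of O_W act on F (x) G, for G a V-resolution of B, and the total
   complex is then the beginning of a minimal V-resolution of O_W.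

   The Betti numbers are those of actual resolutions only because local rings of
   germs are Noetherian.  This is proved by division in the style of standard
   bases.  The monomial of exponent nu is encoded by the integer
   N(nu) = prod_i p_i ^ nu_i, for distinct primes p_i: the integers order the
   monomials, divisibility of integers is divisibility of monomials, and the
   weights N ^ (- s) are multiplicative.  If f_i has initial monomial N_i, then
   for s large the rest of f_i has norm at most half the weight of N_i, so the
   triangular system expressing division by the f_i has a solution of finite
   norm.  Taking for the initial monomials a finite basis of those of an ideal
   (Dickson's lemma) leaves no remainder, so that the f_i generate the ideal;
   division by a single series with initial monomial 1 inverts it. *)

Set Implicit Arguments.
Unset Strict Implicit.
Unset Printing Implicit Defensive.
Import Order.TTheory GRing.Theory Num.Theory.
Import numFieldNormedType.Exports.
Local Open Scope quotient_scope.
Local Open Scope ring_scope.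

Lemma linear_of (A : nzRingType) (U V : lmodType A) (f : U -> V) :
  (forall a u v, f (a *: u + v) = a *: f u + f v) ->
  exists g : {linear U -> V}, forall u, g u = f u.
Proof.
move=> fl.
pose g : {linear U -> V} := HB.pack f (GRing.isLinear.Build A U V *:%R f fl).
by exists g.
Qed.

(** * Independence of the resolution *)

Section Comparison.
Variables (A : comNzRingType) (k : fieldType) (rho : {rmorphism A -> k}).

Lemma lift_rows m n p (D : 'M[A]_(p, n)) (X : 'M[A]_(m, n)) :
  (forall u : 'rV_m, exists v, u *m X = v *m D) -> exists Y, X = Y *m D.
Proof.
move=> h; have /choice[f fP] : forall i, exists v : 'rV_p, row i X = v *m D.
  by move=> i; rewrite rowE; apply: h.
exists (\matrix_i f i); apply/row_matrixP => i.
by rewrite row_mul rowK.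
Qed.

Lemma bdry_comp (M : lmodType A) (F : free_resolution M) i :
  bdry F i.+1 *m bdry F i = 0.
Proof.
apply/row_matrixP => j; rewrite row0 row_mul.
by apply/exact_bdry; exists (delta_mx 0 j); rewrite rowE.
Qed.

Lemma lift_aug (M : lmodType A) (F F' : free_resolution M) :
  exists f : 'M[A]_(rk F 0, rk F' 0), forall u, aug F' (u *m f) = aug F u.
Proof.
have /choice[f fP] : forall i : 'I_(rk F 0), exists v, aug F' v = aug F (delta_mx 0 i).
  by move=> i; exact: aug_surj.
exists (\matrix_i f i) => u.
rewrite mulmx_sum_row linear_sum [in RHS](row_sum_delta u) linear_sum.
by apply: eq_bigr => i _; rewrite !linearZ rowK /= fP.
Qed.

Lemma lift_bdry0 (M : lmodType A) (F F' : free_resolution M)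
    (f : 'M[A]_(rk F 0, rk F' 0)) :
  (forall u, aug F' (u *m f) = aug F u) ->
  exists f', bdry F 0 *m f = f' *m bdry F' 0.
Proof.
move=> fP; apply: lift_rows => u; apply/exact_aug.
by rewrite mulmxA fP; apply/exact_aug; exists u.
Qed.

Lemma lift_bdry (M : lmodType A) (F F' : free_resolution M) i
    (f : 'M[A]_(rk F i, rk F' i)) f' :
  bdry F i *m f = f' *m bdry F' i ->
  exists f'', bdry F i.+1 *m f' = f'' *m bdry F' i.+1.
Proof.
move=> fP; apply: lift_rows => u; apply/exact_bdry.
by rewrite -!mulmxA -fP !mulmxA -(mulmxA u) bdry_comp mulmx0 mul0mx.
Qed.

(** The homotopy lifts because the commutations turn [(f' *m g' - 1%:M - bdry F i *m h) *m bdry F i]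
    into [bdry F i *m (f *m g - 1%:M - h *m bdry F i)]. Multiplying the homotopy relation by
    [bdry F i] kills the homotopy of the previous degree, so the induction carries only one. *)
Lemma comparison_succ (M : lmodType A) (F F' : free_resolution M) i
    (f : 'M[A]_(rk F i, rk F' i)) f' (g : 'M[A]_(rk F' i, rk F i)) g' h :
  bdry F i *m f = f' *m bdry F' i -> bdry F' i *m g = g' *m bdry F i ->
  bdry F i *m (f *m g - 1%:M - h *m bdry F i) = 0 ->
  exists f'' g'' h', [/\ bdry F i.+1 *m f' = f'' *m bdry F' i.+1,
    bdry F' i.+1 *m g' = g'' *m bdry F i.+1 &
    f' *m g' - 1%:M - bdry F i *m h = h' *m bdry F i.+1].
Proof.
move=> ff gg e; have [f'' fE] := lift_bdry ff; have [g'' gE] := lift_bdry gg.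
have [h' hE] : exists h', f' *m g' - 1%:M - bdry F i *m h = h' *m bdry F i.+1.
  apply: lift_rows => u; apply/exact_bdry.
  rewrite -mulmxA !mulmxBl -mulmxA -gg mulmxA -ff mul1mx.
  by rewrite -{2}(mulmx1 (bdry F i)) -!mulmxA -!mulmxBr e mulmx0.
by exists f'', g'', h'.
Qed.

(* [f] and [g] are parts of chain maps between the resolutions, and [h] is part
   of a homotopy from [f] followed by [g] to the identity. *)
Lemma comparison (M : lmodType A) (F F' : free_resolution M) i :
  exists (f : 'M[A]_(rk F i, rk F' i)) f' (g : 'M[A]_(rk F' i, rk F i)) g' h,
  [/\ bdry F i *m f = f' *m bdry F' i,
      bdry F' i *m g = g' *m bdry F i &
      bdry F i *m (f *m g - 1%:M - h *m bdry F i) = 0].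
Proof.
elim: i => [|i [f [f' [g [g' [h [ff gg e]]]]]]].
  have [f fP] := lift_aug F F'; have [g gP] := lift_aug F' F.
  have [f' fE] := lift_bdry0 fP; have [g' gE] := lift_bdry0 gP.
  have [h hE] : exists h, f *m g - 1%:M = h *m bdry F 0.
    apply: lift_rows => u; apply/exact_aug.
    by rewrite mulmxBr mulmx1 raddfB /= mulmxA gP fP subrr.
  by exists f, f', g, g', h; rewrite hE subrr mulmx0.
have [f'' [g'' [h' [fE gE hE]]]] := comparison_succ ff gg e.
exists f', f'', g', g'', h'; split=> //; rewrite -hE.
by rewrite opprB addrC subrK mulmxA bdry_comp mul0mx.
Qed.

(** As [f] followed by [g] is homotopic to the identity, [f] embeds the homology of [d] in that of
    [e]. The quotient by the rows of [e1] is realized by [cokermx e1]. *)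
Lemma homology_dim_le n0 n1 n2 m0 m1 m2 (d0 : 'M[k]_(n1, n0)) (d1 : 'M[k]_(n2, n1))
    (e0 : 'M[k]_(m1, m0)) (e1 : 'M[k]_(m2, m1)) f0 (f : 'M_(n1, m1)) (g : 'M_(m1, n1))
    g2 h h' :
  e1 *m e0 = 0 -> d0 *m f0 = f *m e0 -> e1 *m g = g2 *m d1 ->
  f *m g = 1%:M + d0 *m h + h' *m d1 ->
  (\rank (kermx d0) - \rank d1 <= \rank (kermx e0) - \rank e1)%N.
Proof.
move=> ee df eg fg.
have kle : (kermx d0 :&: kermx (f *m cokermx e1) <= d1)%MS.
  apply/rV_subP => u; rewrite sub_capmx => /andP[/sub_kermxP ud /sub_kermxP].
  rewrite mulmxA => /eqP; rewrite -submxE => /submxP[v uf].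
  have <- : u *m f *m g - u *m h' *m d1 = u.
    rewrite -!mulmxA fg !mulmxDr mulmx1 (mulmxA u d0) ud mul0mx addr0.
    by rewrite addrK.
  by rewrite uf -mulmxA eg !mulmxA -mulmxBl submxMl.
have rle : (\rank (kermx d0 *m (f *m cokermx e1)) <= \rank (kermx e0 *m cokermx e1))%N.
  rewrite mulmxA; apply/mxrankS/submxMr/sub_kermxP.
  by rewrite -mulmxA -df mulmxA mulmx_ker mul0mx.
have e1le : (e1 <= kermx e0 :&: kermx (cokermx e1))%MS.
  by rewrite sub_capmx; apply/andP; split; apply/sub_kermxP; rewrite ?mulmx_coker.
have := mxrank_mul_ker (kermx d0) (f *m cokermx e1).
have := mxrank_mul_ker (kermx e0) (cokermx e1).
move: (mxrankS kle) (mxrankS e1le) rle.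
move: (\rank _) (\rank _) (\rank _) (\rank _) (\rank _) (\rank _) (\rank _) (\rank _).
by move=> *; lia.
Qed.

Lemma tor_dim_le (M : lmodType A) (F F' : free_resolution M) i :
  (tor_dim rho F i <= tor_dim rho F' i)%N.
Proof.
have mapE m n p (X : 'M_(m, n)) (Y : 'M_(n, p)) := map_mxM rho X Y.
case: i => [|i] /=.
  have [f fP] := lift_aug F F'; have [g gP] := lift_aug F' F.
  have [f' fE] := lift_bdry0 fP; have [g' gE] := lift_bdry0 gP.
  have [h hE] : exists h, f *m g - 1%:M = h *m bdry F 0.
    apply: lift_rows => u; apply/exact_aug.
    by rewrite mulmxBr mulmx1 raddfB /= mulmxA gP fP subrr.
  (* In degree 0 the outgoing differential is the zero map to the zero space. *)
  have := @homology_dim_le 0 _ _ 0 _ _ 0 (map_mx rho (bdry F 0)) 0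
    (map_mx rho (bdry F' 0)) 0 (map_mx rho f) (map_mx rho g) (map_mx rho g') 0 (map_mx rho h).
  rewrite !mxrank_ker !mxrank0 !subn0; apply; rewrite ?mulmx0 ?mul0mx //.
    by rewrite -!mapE gE.
  rewrite addr0 -!mapE -hE raddfB /= map_mx1 addrC subrK //.
have [f [f' [g [g' [h [ff gg' e]]]]]] := comparison F F' i.
have [f'' [g'' [h' [ff' gg hE]]]] := comparison_succ ff gg' e.
have {}e : f' *m g' = 1%:M + bdry F i *m h + h' *m bdry F i.+1.
  by move/eqP: hE; rewrite -addrA -opprD subr_eq addrC => /eqP.
apply: (@homology_dim_le _ _ _ _ _ _ _ _ _ _ (map_mx rho f) (map_mx rho f')
  (map_mx rho g') (map_mx rho g'') (map_mx rho h) (map_mx rho h')).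
- by rewrite -mapE bdry_comp map_mx0.
- by rewrite -!mapE ff.
- by rewrite -!mapE gg.
- by rewrite -!mapE e !raddfD /= map_mx1.
Qed.

(** Exchanging the resolutions in [tor_dim_le] gives equality, so the choice made by [xget] is
    immaterial, and [F] excludes its default 0. *)
Lemma bettiE (M : lmodType A) (F : free_resolution M) i :
  betti rho M i = tor_dim rho F i.
Proof.
rewrite /betti; case: xgetP => [b _ [F' <-]|/(_ (tor_dim rho F i))].
  by apply/eqP; rewrite eqn_leq !tor_dim_le.
by move=> /(_ _)[]; exists F.
Qed.
End Comparison.

(** * Finite generation *)

Definition submodule (A : comNzRingType) (M : lmodType A) (S : M -> Prop) : Prop :=
  S 0 /\ forall a u v, S u -> S v -> S (a *: u + v).

Definition fin_gen (A : comNzRingType) (M : lmodType A) (S : M -> Prop) : Prop :=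
  exists (q : nat) (p : {linear 'rV[A]_q -> M}), forall u, S u <-> exists v, u = p v.

Definition noetherian (A : comNzRingType) : Prop :=
  forall S : A^o -> Prop, submodule S -> fin_gen S.

(** In other words, [A] is local with maximal ideal the kernel of [rho]. *)
Definition is_local (A : comNzRingType) (k : fieldType) (rho : {rmorphism A -> k}) :=
  forall a, rho a != 0 -> exists b, a * b = 1.

Section FinGen.
Variable A : comNzRingType.

Lemma linear_of_seq (M : lmodType A) q (e : 'I_q -> M) :
  exists p : {linear 'rV[A]_q -> M}, forall v, p v = \sum_i v 0 i *: e i.
Proof.
apply: linear_of => a u v; rewrite scaler_sumr -big_split; apply: eq_bigr => i _.
by rewrite !mxE scalerDl scalerA.
Qed.

Lemma linear_sumE (M : lmodType A) q (p : {linear 'rV[A]_q -> M}) v :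
  p v = \sum_i v 0 i *: p (delta_mx 0 i).
Proof.
by rewrite {1}(row_sum_delta v) linear_sum; apply: eq_bigr => i _; rewrite linearZ.
Qed.

Lemma fin_genP (M : lmodType A) (S : M -> Prop) : submodule S ->
  fin_gen S <-> exists q (e : 'I_q -> M), (forall i, S (e i)) /\
    forall u, S u -> exists v : 'I_q -> A, u = \sum_i v i *: e i.
Proof.
move=> [S0 SD]; split=> [[q [p Sp]]|[q [e [Se eS]]]].
  exists q, (fun i => p (delta_mx 0 i)); split=> [i|u /Sp[v ->]].
    by apply/Sp; exists (delta_mx 0 i).
  by exists (v 0); exact: linear_sumE.
have [p pE] := linear_of_seq e; exists q, p => u; split=> [/eS[v ->]|[v ->]].
  exists (\row_i v i); rewrite pE; apply: eq_bigr => i _; by rewrite mxE.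
rewrite pE; elim/big_ind: _ => // [x y Sx Sy|i _].
  by rewrite -[x]scale1r; exact: SD.
by rewrite -[_ *: _]addr0; exact: SD.
Qed.

(** Induction on [t]: the first coordinates of [S] form an ideal [S1], the members with first
    coordinate 0 a submodule [S2] in rank [t]. Generators of [S1], lifted to [S], and those of [S2]
    together generate [S]. *)
Lemma noetherian_rV t (S : 'rV[A]_t -> Prop) :
  noetherian A -> submodule S -> fin_gen S.
Proof.
move=> noeA; elim: t S => [|t IH] S sS.
  apply/(fin_genP sS); exists 0%N, (fun=> 0); split=> [[]//|u _].
  by exists (fun=> 0); rewrite big_ord0 (thinmx0 u).
have [S0 SD] := sS.
pose S1 (r : A^o) := exists u : 'rV_t, S (row_mx r%:M u).
pose S2 (u : 'rV_t) := S (row_mx (0 : 'rV_1) u).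
have sS1 : submodule S1.
  split=> [|a r s [u Su] [v Sv]]; first by exists 0; rewrite raddf0 row_mx0.
  exists (a *: u + v); rewrite (_ : row_mx _ _ = a *: row_mx r%:M u + row_mx s%:M v).
    exact: SD.
  by rewrite scale_row_mx add_row_mx scale_scalar_mx raddfD.
have sS2 : submodule S2.
  split=> [|a u v Su Sv]; first by rewrite /S2 row_mx0.
  rewrite /S2 (_ : row_mx _ _ = a *: row_mx 0 u + row_mx 0 v); first exact: SD.
  by rewrite scale_row_mx add_row_mx scaler0 addr0.
have /(fin_genP sS1)[q1 [e1 [Se1 e1S]]] := noeA _ sS1.
have /(fin_genP sS2)[q2 [e2 [Se2 e2S]]] := IH _ sS2.
have /choice[f fP] := Se1.
apply/(fin_genP sS).
pose e (i : 'I_(q1 + q2)) : 'rV[A]_(1 + t) :=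
  match split i with inl j => row_mx (e1 j)%:M (f j) | inr j => row_mx 0 (e2 j) end.
exists (q1 + q2)%N, e; split=> [i|u Su]; first by rewrite /e; case: split => j;
  [exact: fP|exact: Se2].
have [v1 v1E] : exists v, lsubmx (u : 'rV_(1 + t)) 0 0 = \sum_i v i *: e1 i.
  apply: e1S; exists (rsubmx (u : 'rV_(1 + t))).
  by rewrite -mx11_scalar hsubmxK.
pose w := \sum_i v1 i *: row_mx (e1 i)%:M (f i).
have Sw : S w.
  rewrite /w; elim/big_ind: _ => // [x y Sx Sy|i _].
    by rewrite -[x]scale1r; exact: SD.
  by rewrite -[_ *: _]addr0; exact: SD.
pose uw : 'rV_(1 + t) := u - w.
have Suw : S uw by rewrite /uw addrC -scaleN1r; exact: SD.
have l0 : lsubmx uw = 0.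
  rewrite linearB /= [X in X - _]mx11_scalar v1E; apply/eqP; rewrite subr_eq0; apply/eqP.
  rewrite /w linear_sum raddf_sum; apply: eq_bigr => i _.
  by rewrite linearZ /= row_mxKl scale_scalar_mx.
have [v2 v2E] : exists v, rsubmx uw = \sum_i v i *: e2 i.
  by apply: e2S; rewrite /S2 -l0 hsubmxK.
exists (fun i => match split i with inl j => v1 j | inr j => v2 j end).
rewrite big_split_ord /= -[LHS](subrK w) [LHS]addrC; congr (_ + _).
  apply: eq_bigr => i _; rewrite /e; have -> : split (lshift q2 i) = inl i := unsplitK (inl i).
  by [].
rewrite -/uw; transitivity (row_mx (0 : 'rV_1) (rsubmx uw)).
  by rewrite -l0 hsubmxK.
rewrite v2E; have -> : row_mx (0 : 'rV_1) (\sum_i v2 i *: e2 i) = \sum_i v2 i *: row_mx (0 :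
  'rV_1) (e2 i).
  elim/big_rec2: _ => [|i x y _ <-]; first by rewrite row_mx0.
  by rewrite scale_row_mx add_row_mx scaler0 add0r.
apply: eq_bigr => i _; rewrite /e; have -> : split (rshift q1 i) = inr i := unsplitK (inr i).
by [].
Qed.

Lemma submodule_ker (M N : lmodType A) (p : {linear M -> N}) :
  submodule (fun u => p u = 0).
Proof.
by split=> [|a u v u0 v0]; rewrite ?linear0 // linearP u0 v0 scaler0 addr0.
Qed.

Variables (k : fieldType) (rho : {rmorphism A -> k}).

(* A generating family with the least number of members has no relation with
   an invertible coefficient. *)
Lemma min_generators (M : lmodType A) (S : M -> Prop) :
  is_local rho -> submodule S -> fin_gen S ->
  exists q (p : {linear 'rV[A]_q -> M}), (forall u, S u <-> exists v, u = p v) /\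
    forall v, p v = 0 -> map_mx rho v = 0.
Proof.
move=> loc sS fg.
pose P q := `[< exists p : {linear 'rV[A]_q -> M}, forall u, S u <-> exists v, u = p v >].
have exP : exists q, P q by have [q [p pS]] := fg; exists q; apply/asboolP; exists p.
case: (ex_minnP exP) => q /asboolP[p pS] qmin; exists q, p; split=> // v pv0.
apply: contrapT => vn0.
have [i vi] : exists i, rho (v 0 i) != 0.
  apply: contrapT => h; apply: vn0; apply/rowP => i; rewrite !mxE.
  by apply/eqP; apply: contrapT => /negP hi; apply: h; exists i.
case: q p pS qmin v pv0 i vi {vn0} => [|q] p pS qmin v pv0 i vi; first by case: (i).
have [r vr] := loc _ vi.
suff /qmin : P q by rewrite ltnn.
apply/asboolP; pose e j := p (delta_mx 0 (lift i j)).
have [p' p'E] := linear_of_seq e; exists p' => u; split.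
  (* The relation [v] eliminates the generator of index [i]: [w'] has the same image as [w], and its
     coordinate [i] is 0. *)
  move=> /pS[w ->]; pose w' := w - (w 0 i * r) *: v.
  exists (\row_j w' 0 (lift i j)).
  have -> : p w = p w' by rewrite /w' linearB linearZ /= pv0 scaler0 subr0.
  rewrite linear_sumE (bigD1_ord i) //= p'E {1}/w' !mxE -mulrA (mulrC r) vr mulr1.
  by rewrite subrr scale0r add0r; apply: eq_bigr => j _; rewrite [in RHS]mxE.
move=> [w ->]; apply/pS; exists (\sum_j w 0 j *: delta_mx 0 (lift i j)).
by rewrite p'E linear_sum; apply: eq_bigr => j _; rewrite linearZ.
Qed.

End FinGen.

(** * Minimal presentations *)

(* A minimal free resolution up to degree 2; minimality says that the kernels
   have their entries in the maximal ideal [ker rho]. *)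
Definition min_pres (A : comNzRingType) (k : fieldType) (rho : {rmorphism A -> k})
    (M : lmodType A) (t0 t1 t2 : nat) : Prop :=
  exists (p : {linear 'rV[A]_t0 -> M}) (d0 : {linear 'rV[A]_t1 -> 'rV[A]_t0})
         (d1 : {linear 'rV[A]_t2 -> 'rV[A]_t1}),
  [/\ forall y, exists u, p u = y,
      forall u, p u = 0 <-> exists v, u = d0 v &
      forall u, d0 u = 0 <-> exists v, u = d1 v] /\
  [/\ forall u, p u = 0 -> map_mx rho u = 0,
      forall u, d0 u = 0 -> map_mx rho u = 0 &
      forall u, d1 u = 0 -> map_mx rho u = 0].

Section MinPres.
Variables (A : comNzRingType) (k : fieldType) (rho : {rmorphism A -> k}).
Hypothesis noeA : noetherian A.

Lemma fin_gen_mx t (S : 'rV[A]_t -> Prop) : submodule S ->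
  exists q (D : 'M[A]_(q, t)), forall u, S u <-> exists v, u = v *m D.
Proof.
move=> sS; have [q [p pS]] := noetherian_rV noeA sS.
by exists q, (lin1_mx p) => u; rewrite pS; split=> -[v ->]; exists v; rewrite mul_rV_lin1.
Qed.

Lemma next_syzygy t t' (D : 'M[A]_(t', t)) :
  exists q (D' : 'M[A]_(q, t')), forall u : 'rV_t', u *m D = 0 <-> exists v, u = v *m D'.
Proof.
by apply: fin_gen_mx; split=> [|a u v u0 v0];
  rewrite ?mul0mx // mulmxDl -scalemxAl u0 v0 scaler0 addr0.
Qed.

(** Iterating [next_syzygy] continues the two given matrices into an infinite resolution; degrees up
    to 2 involve only one more differential, [D2]. *)
Lemma resolution_from (M : lmodType A) t0 t1 t2 (p : {linear 'rV[A]_t0 -> M})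
    (D0 : 'M[A]_(t1, t0)) (D1 : 'M[A]_(t2, t1)) :
  (forall y, exists u, p u = y) -> (forall u, p u = 0 <-> exists v, u = v *m D0) ->
  (forall u : 'rV_t1, u *m D0 = 0 <-> exists v, u = v *m D1) ->
  exists F : free_resolution M, exists D2 : 'M_(rk F 3, t2),
    [/\ D1 *m D0 = 0, D2 *m D1 = 0, tor_dim rho F 0 = (t0 - \rank (map_mx rho D0))%N,
     tor_dim rho F 1 =
       (\rank (kermx (map_mx rho D0)) - \rank (map_mx rho D1))%N &
     tor_dim rho F 2 = (\rank (kermx (map_mx rho D1)) - \rank (map_mx rho D2))%N].
Proof.
move=> ps p0 p1.
pose st := {t : nat & {t' : nat & 'M[A]_(t', t)}}.
have next_ex (s : st) : exists D' : {q : nat & 'M[A]_(q, projT1 (projT2 s))},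
    forall u : 'rV_(projT1 (projT2 s)),
      u *m projT2 (projT2 s) = 0 <-> exists v, u = v *m projT2 D'.
  by have [q [D' D'P]] := next_syzygy (projT2 (projT2 s)); exists (existT _ q D').
(* The target rank of the new matrix is by definition the source rank of the old one, so that
   consecutive differentials compose without casts. *)
pose next (s : st) : st := existT _ (projT1 (projT2 s)) (projT1 (cid (next_ex s))).
pose s := fix s i : st := if i is j.+1 then next (s j) else existT _ t1 (existT _ t2 D1).
pose r i := if i is j.+1 then projT1 (s j) else t0.
pose d i : 'M[A]_(r i.+1, r i) :=
  match i return 'M[A]_(r i.+1, r i) with
  | 0%N => D0
  | j.+1 => projT2 (projT2 (s j))
  end.
have ex i (u : 'rV[A]_(r i.+1)) : u *m d i = 0 <-> exists v, u = v *m d i.+1.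
  case: i u => [|i] u; first exact: p1.
  exact: (projT2 (cid (next_ex (s i)))).
have dd i : d i.+1 *m d i = 0.
  apply/row_matrixP => j; rewrite row0 row_mul.
  by apply/ex; exists (delta_mx 0 j); rewrite rowE.
exists (@FreeResolution A M r d p ps p0 ex), (d 2); split=> //; exact: (dd 0).
Qed.

Lemma map_mx0P m n (X : 'M[A]_(m, n)) :
  (forall u : 'rV_m, map_mx rho (u *m X) = 0) -> map_mx rho X = 0.
Proof.
by move=> h; apply/row_matrixP => i; rewrite row0 -map_row rowE.
Qed.

(** By minimality the differentials vanish after tensoring with [k], so the Betti numbers are the
    ranks. For degree 2, the rows of [D2] lie in the kernel of [d1]. *)
Lemma betti_min_pres (M : lmodType A) t0 t1 t2 : min_pres rho M t0 t1 t2 ->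
  [/\ betti rho M 0 = t0, betti rho M 1 = t1 & betti rho M 2 = t2].
Proof.
move=> [p [d0 [d1 [[ps p0 p1] [m0 m1 m2]]]]].
have p0' u : p u = 0 <-> exists v, u = v *m lin1_mx d0.
  by rewrite p0; split=> -[v ->]; exists v; rewrite mul_rV_lin1.
have p1' (u : 'rV_t1) : u *m lin1_mx d0 = 0 <-> exists v, u = v *m lin1_mx d1.
  by rewrite mul_rV_lin1 p1; split=> -[v ->]; exists v; rewrite mul_rV_lin1.
have [F [D2 [e10 e21 b0 b1 b2]]] := resolution_from ps p0' p1'.
have D0 : map_mx rho (lin1_mx d0) = 0 by apply: map_mx0P => u; apply/m0/p0'; exists u.
have D1 : map_mx rho (lin1_mx d1) = 0 by apply: map_mx0P => u; apply/m1/p1; exists u;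
  rewrite mul_rV_lin1.
have D2' : map_mx rho D2 = 0.
  by apply: map_mx0P => u; apply: m2; rewrite -mul_rV_lin1 -mulmxA e21 mulmx0.
by rewrite !(bettiE rho F) b0 b1 b2 D0 D1 D2' !mxrank_ker !mxrank0 !subn0.
Qed.

Hypothesis loc : is_local rho.

Lemma min_pres_ext (M : lmodType A) t0 (p : {linear 'rV[A]_t0 -> M}) :
  (forall y, exists u, p u = y) -> (forall u, p u = 0 -> map_mx rho u = 0) ->
  exists t1 t2, min_pres rho M t0 t1 t2.
Proof.
move=> ps pm.
have [t1 [d0 [e0 m0]]] := min_generators loc (submodule_ker p) (noetherian_rV noeA (submodule_ker
  p)).
have [t2 [d1 [e1 m1]]] := min_generators loc (submodule_ker d0) (noetherian_rV noeA
  (submodule_ker d0)).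
by exists t1, t2, p, d0, d1.
Qed.

Lemma min_pres_exists (M : lmodType A) : fin_gen (fun _ : M => True) ->
  exists t0 t1 t2, min_pres rho M t0 t1 t2.
Proof.
move=> fg; have sT : submodule (fun _ : M => True) by [].
have [t0 [p [pT pm]]] := min_generators loc sT fg.
exists t0; have := @min_pres_ext _ _ p; apply=> // y.
by have [v ->] := (pT y).1 I; exists v.
Qed.

End MinPres.

(** Coefficients lift along the surjection [phi], so minimal generators over [A] still generate over
    [V], and they stay minimal because the residue maps agree. Only the rank [t0] is kept. *)
Lemma min_pres_restr (V A : comNzRingType) (k : fieldType) (rhoV : {rmorphism V -> k})
    (rho : {rmorphism A -> k}) (phi : {rmorphism V -> A}) (M : lmodType A) t0 t1 t2 :
  noetherian V -> is_local rhoV -> (forall s, exists r, phi r = s) ->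
  (forall r, rho (phi r) = rhoV r) -> min_pres rho M t0 t1 t2 ->
  exists t1' t2', min_pres rhoV (restr phi M) t0 t1' t2'.
Proof.
move=> noeV locV phis rhoE [p [_ [_ [[ps _ _] [pm _ _]]]]].
have [p' p'E] : exists p' : {linear 'rV[V]_t0 -> restr phi M}, forall u, p' u = p (map_mx phi u).
  by apply: linear_of => a u v; rewrite map_mxD map_mxZ linearP.
apply: (min_pres_ext noeV locV (p := p')) => [y|u].
  have [u <-] := ps y; have /choice[f fP] := fun i => phis (u 0 i).
  exists (\row_i f i); rewrite p'E; congr (p _); apply/rowP => i.
  by rewrite !mxE fP.
rewrite p'E => /pm h; rewrite -[RHS]h; apply/rowP => i.
by rewrite !mxE rhoE.
Qed.

(** * Resolutions of cyclic modules *)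

Section Cyclic.
Variables (A : comNzRingType) (k : fieldType) (rho : {rmorphism A -> k}).

Lemma map_row_mx0 m n (u : 'rV[A]_(m + n)) :
  map_mx rho (lsubmx u) = 0 -> map_mx rho (rsubmx u) = 0 -> map_mx rho u = 0.
Proof. by move=> l r; rewrite -(hsubmxK u) map_row_mx l r row_mx0. Qed.

(** The kernel of [p] is the direct sum of [N1] and [N2], so the sum of their resolutions, shifted
    by one degree, continues a free module of rank 1. *)
Lemma min_pres_cyclic (M N1 N2 : lmodType A) (p : {linear A^o -> M})
    (q1 : {linear N1 -> A^o}) (q2 : {linear N2 -> A^o}) k0 k1 k2 j0 j1 j2 :
  (forall y, exists r, p r = y) ->
  (forall r, p r = 0 <-> exists n1 n2, r = q1 n1 + q2 n2) ->
  (forall n1 n2, q1 n1 + q2 n2 = 0 -> n1 = 0 /\ n2 = 0) ->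
  (forall n1, rho (q1 n1) = 0) -> (forall n2, rho (q2 n2) = 0) ->
  min_pres rho N1 k0 k1 k2 -> min_pres rho N2 j0 j1 j2 ->
  min_pres rho M 1 (k0 + j0) (k1 + j1).
Proof.
move=> ps pker qinj m1 m2 [p1 [d0 [d1 [[s1 e1 f1] [a1 b1 c1]]]]].
move=> [p2 [g0 [g1 [[s2 e2 f2] [a2 b2 c2]]]]].
have [P PE] : exists P : {linear 'rV[A]_1 -> M}, forall u, P u = p (u 0 0).
  by apply: linear_of => a u v; rewrite !mxE linearP.
have [D0 D0E] : exists D0 : {linear 'rV[A]_(k0 + j0) -> 'rV[A]_1},
    forall u, D0 u = (q1 (p1 (lsubmx u)) + q2 (p2 (rsubmx u)))%:M.
  apply: linear_of => a u v; rewrite !linearP /=.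
  apply/rowP => i; rewrite !mxE ord1 eqxx !mulr1n mulrDr !addrA.
  by congr (_ + _); rewrite -!addrA; congr (_ + _); rewrite addrC.
have [D1 D1E] : exists D1 : {linear 'rV[A]_(k1 + j1) -> 'rV[A]_(k0 + j0)},
    forall u, D1 u = row_mx (d0 (lsubmx u)) (g0 (rsubmx u)).
  by apply: linear_of => a u v; rewrite !linearP scale_row_mx add_row_mx.
exists P, D0, D1; split; split.
- by move=> y; have [r <-] := ps y; exists r%:M; rewrite PE mxE eqxx mulr1n.
- move=> u; rewrite PE pker; split=> [[n1 [n2 uE]]|[v ->]].
    have [v1 v1E] := s1 n1; have [v2 v2E] := s2 n2; exists (row_mx v1 v2).
    by rewrite D0E row_mxKl row_mxKr v1E v2E -uE -mx11_scalar.
  by exists (p1 (lsubmx v)), (p2 (rsubmx v)); rewrite D0E mxE eqxx mulr1n.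
- move=> u; rewrite D0E; split=> [|[v ->]].
    move=> /matrixP/(_ 0 0); rewrite !mxE eqxx mulr1n => /qinj[/e1[v1 v1E] /e2[v2 v2E]].
    by exists (row_mx v1 v2); rewrite D1E row_mxKl row_mxKr -v1E -v2E hsubmxK.
  rewrite D1E row_mxKl row_mxKr.
  have -> : p1 (d0 (lsubmx v)) = 0 by apply/e1; exists (lsubmx v).
  have -> : p2 (g0 (rsubmx v)) = 0 by apply/e2; exists (rsubmx v).
  by rewrite !linear0 addr0 raddf0.
- move=> u; rewrite PE pker => -[n1 [n2 uE]]; apply/rowP => i.
  by rewrite !mxE ord1 uE rmorphD /= m1 m2 addr0.
- move=> u; rewrite D0E.
  move=> /matrixP/(_ 0 0); rewrite !mxE eqxx mulr1n => /qinj[/a1 l /a2 r].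
  exact: map_row_mx0.
- move=> u; rewrite D1E => E.
  have [/b1 l /b2 r] : d0 (lsubmx u) = 0 /\ g0 (rsubmx u) = 0.
    by apply: eq_row_mx; rewrite E row_mx0.
  exact: map_row_mx0.
Qed.

Lemma min_pres0 : min_pres rho 'rV[A]_0 0 0 0.
Proof.
have m0 (u : 'rV[A]_0) : map_mx rho u = 0 by rewrite (thinmx0 u) map_mx0.
exists idfun, idfun, idfun; split; split=> // [y|u|u]; first by exists y.
  by split=> _; [exists u | rewrite (thinmx0 u)].
by split=> _; [exists u | rewrite (thinmx0 u)].
Qed.

Lemma min_pres_quo (M N : lmodType A) (p : {linear A^o -> M})
    (q : {linear N -> A^o}) k0 k1 k2 :
  (forall y, exists r, p r = y) ->
  (forall r, p r = 0 <-> exists n, r = q n) ->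
  (forall n, q n = 0 -> n = 0) ->
  (forall n, rho (q n) = 0) ->
  min_pres rho N k0 k1 k2 -> min_pres rho M 1 k0 k1.
Proof.
move=> ps pker qinj m1 h.
have [z zE] : exists z : {linear 'rV[A]_0 -> A^o}, forall u, z u = 0.
  by apply: linear_of => a u v; rewrite scaler0 addr0.
rewrite -(addn0 k0) -(addn0 k1).
apply: (@min_pres_cyclic M N _ p q z k0 k1 k2 0 0 0) => //.
- move=> r; rewrite pker; split=> [[n ->]|[n [? ->]]]; last by exists n; rewrite zE addr0.
  by exists n, 0; rewrite zE addr0.
- by move=> n u; rewrite zE addr0 => /qinj ->; rewrite (thinmx0 u).
- by move=> u; rewrite zE rmorph0.
- exact: min_pres0.
Qed.
End Cyclic.

(** * Change of rings along a retraction *)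

Section Retract.
Variables (V B : comNzRingType) (k : fieldType) (rhoV : {rmorphism V -> k})
  (rhoB : {rmorphism B -> k}) (pi : {rmorphism V -> B}) (sg : {rmorphism B -> V}).
Hypothesis sgK : forall b, pi (sg b) = b.
Hypothesis rhoE : forall v, rhoB (pi v) = rhoV v.

(* The terms of degree at most two of the total complex of [F ⊗ G], where [F] is
   a resolution of [M] over [B] and [G] one of [B] over [V]; [F_i ⊗ G_j] consists
   of matrices, and the section [sg] makes the differentials of [F] act on it. *)
Lemma min_pres_retract (M : lmodType B) (N : lmodType V) (q : {linear N -> V^o})
    w0 w1 w2 k0 k1 k2 :
  (forall r, pi r = 0 <-> exists n, r = q n) ->
  (forall n, q n = 0 -> n = 0) ->
  min_pres rhoB M w0 w1 w2 -> min_pres rhoV N k0 k1 k2 ->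
  min_pres rhoV (restr pi M) w0 (w1 + w0 * k0) (w2 + (w1 * k0 + w0 * k1)).
Proof.
move=> piker qinj [p [d0 [d1 [[ps e0 e1] [a0 a1 a2]]]]].
move=> [P [g1 [g2 [[Ps E0 E1] [A0 A1 A2]]]]].
pose D0 := map_mx sg (lin1_mx d0); pose D1 := map_mx sg (lin1_mx d1).
pose G0 := \col_i (q (P (delta_mx 0 i)) : V); pose G1 := lin1_mx g1.
have piD m n (X : 'M_(m, n)) : map_mx pi (map_mx sg X) = X.
  by rewrite -map_mx_comp map_mx_id.
have rpi m n (X : 'M_(m, n)) : map_mx rhoV X = map_mx rhoB (map_mx pi X).
  by rewrite -map_mx_comp; apply: eq_map_mx => x /=; rewrite rhoE.
(* This holds over [V] itself because [sg] is a ring morphism; for arbitrary lifts of the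
   differentials it would be guaranteed only modulo the kernel of [pi]. *)
have D10 : D1 *m D0 = 0.
  rewrite -map_mxM (_ : _ *m _ = 0) ?map_mx0 //; apply/row_matrixP => i.
  by rewrite row0 rowE mulmxA !mul_rV_lin1; apply/e1; exists (delta_mx 0 i).
have G0E m (E : 'M_(m, k0)) i : (E *m G0) i 0 = q (P (row i E)).
  rewrite mxE linear_sumE linear_sum; apply: eq_bigr => j _.
  by rewrite linearZ /= !mxE.
have piG m (E : 'M_(m, k0)) : map_mx pi (E *m G0)^T = 0.
  by apply/matrixP => i j; rewrite mxE [X in pi X]mxE ord1 G0E [RHS]mxE; apply/piker;
    exists (P (row j E)).
(* The entries of [G0] generate the kernel of [pi]; row [i] of [E] holds the coefficients of
   coordinate [i] of [u]. *)
have kerpi m (u : 'rV_m) : map_mx pi u = 0 -> exists E : 'M_(m, k0), u = (E *m G0)^T.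
  move=> pu; have /choice[f fE] : forall i, exists w, u 0 i = q (P w).
    move=> i; have /piker[n ->] : pi (u 0 i) = 0.
      by move/rowP/(_ i): pu; rewrite !mxE.
    by have [w <-] := Ps n; exists w.
  by exists (\matrix_i f i); apply/rowP => i; rewrite mxE G0E rowK.
have kerG m (E : 'M_(m, k0)) : E *m G0 = 0 -> forall i, P (row i E) = 0.
  by move=> EG i; apply: qinj; rewrite -G0E EG mxE.
have kerG0 m (E : 'M_(m, k0)) : E *m G0 = 0 -> exists v, E = v *m G1.
  move=> /kerG EG; have /choice[f fE] : forall i, exists v, row i E = g1 v.
    by move=> i; apply/E0/EG.
  by exists (\matrix_i f i); apply/row_matrixP => i; rewrite row_mul rowK mul_rV_lin1.
have G10 m (E : 'M_(m, k1)) : E *m G1 *m G0 = 0.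
  apply/matrixP => i j; rewrite ord1 G0E row_mul mul_rV_lin1 !mxE.
  by rewrite (_ : P _ = 0) ?linear0 //; apply/E0; exists (row i E).
have mG0 m (E : 'M_(m, k0)) : E *m G0 = 0 -> map_mx rhoV E = 0.
  move=> /kerG EG; apply/row_matrixP => i.
  by rewrite row0 -map_row; apply: A0.
have mG1 m (E : 'M_(m, k1)) : E *m G1 = 0 -> map_mx rhoV E = 0.
  move=> EG; apply/row_matrixP => i; rewrite row0 -map_row; apply: A1.
  by rewrite -mul_rV_lin1 -row_mul EG row0.
have [PT PTE] : exists PT : {linear 'rV[V]_w0 -> restr pi M},
    forall u, PT u = p (map_mx pi u).
  by apply: linear_of => a u v; rewrite map_mxD map_mxZ linearP.
have [T0 T0E] : exists T0 : {linear 'rV[V]_(w1 + w0 * k0) -> 'rV[V]_w0}, forall z,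
    T0 z = lsubmx z *m D0 + (vec_mx (rsubmx z) *m G0)^T.
  apply: linear_of => a u v; rewrite !linearP /= !mulmxDl -!scalemxAl linearP /=.
  by rewrite scalerDr addrACA.
(* The minus sign of the total complex makes the two paths from F_1 ⊗ G_1 to F_0 ⊗ G_0 cancel. *)
have [T1 T1E] : exists T1 :
   {linear 'rV[V]_(w2 + (w1 * k0 + w0 * k1)) -> 'rV[V]_(w1 + w0 * k0)}, forall z,
    T1 z = row_mx (lsubmx z *m D1 + (vec_mx (lsubmx (rsubmx z)) *m G0)^T)
      (mxvec (vec_mx (rsubmx (rsubmx z)) *m G1 - D0^T *m vec_mx (lsubmx (rsubmx z)))).
  apply: linear_of => a u v; rewrite scale_row_mx add_row_mx -linearP /=.
  congr (row_mx _ (mxvec _)).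
    by rewrite !linearP /= !mulmxDl -!scalemxAl linearP /= scalerDr addrACA.
  rewrite !linearP /= mulmxDl -scalemxAl scalerDr.
  by rewrite addrACA.
have trE l m (e : 'M_(l, k0)) (D : 'M_(l, m)) : (D^T *m e *m G0)^T = (e *m G0)^T *m D.
  by rewrite -mulmxA trmx_mul trmxK.
have exT z : T0 z = 0 <-> exists y, z = T1 y.
  rewrite T0E; split=> [zE|[y ->]]; last first.
    rewrite T1E row_mxKl row_mxKr mxvecK mulmxDl -mulmxA D10 mulmx0 add0r mulmxBl G10.
    by rewrite sub0r raddfN /= trE subrr.
  (* Diagram chase: [y] accounts for the image by [pi] of the first component, [e] for the rest of
     that component, which lies in the kernel of [pi], and [v] for what then remains of the
     second. *)
  have [y yE] : exists y, map_mx pi (lsubmx z) = d1 y.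
    apply/e1; move/(congr1 (map_mx pi)): zE.
    by rewrite map_mxD piG addr0 map_mxM map_mx0 piD mul_rV_lin1.
  have [e eE] : exists e : 'M_(w1, k0), lsubmx z - map_mx sg y *m D1 = (e *m G0)^T.
    by apply: kerpi; rewrite map_mxB map_mxM !piD yE mul_rV_lin1 subrr.
  have lE : lsubmx z = map_mx sg y *m D1 + (e *m G0)^T by rewrite -eE addrC subrK.
  have [v vE] : exists v, vec_mx (rsubmx z) + D0^T *m e = v *m G1.
    apply: kerG0; apply: trmx_inj; rewrite mulmxDl linearD /= trmx0 -zE addrC.
    by congr (_ + _); rewrite trE lE mulmxDl -mulmxA D10 mulmx0 add0r.
  exists (row_mx (map_mx sg y) (row_mx (mxvec e) (mxvec v))).
  rewrite T1E !(row_mxKl, row_mxKr, mxvecK) -lE -vE addrK vec_mxK.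
  by rewrite hsubmxK.
have rD0 : map_mx rhoV D0 = 0.
  rewrite rpi piD; apply: map_mx0P => u; rewrite mul_rV_lin1; apply/a0/e0.
  by exists u.
have rD1 : map_mx rhoV D1 = 0.
  rewrite rpi piD; apply: map_mx0P => u; rewrite mul_rV_lin1; apply/a1/e1.
  by exists u.
have rG1 : map_mx rhoV G1 = 0.
  by apply: map_mx0P => u; rewrite mul_rV_lin1; apply/A0/E0; exists u.
exists PT, T0, T1; split; split.
- move=> y; have [u <-] := ps y; exists (map_mx sg u).
  by rewrite PTE piD.
- move=> u; rewrite PTE e0; split=> [[v vE]|[v ->]].
    have [E uE] : exists E : 'M_(w0, k0), u - map_mx sg v *m D0 = (E *m G0)^T.
      by apply: kerpi; rewrite map_mxB map_mxM !piD vE mul_rV_lin1 subrr.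
    by exists (row_mx (map_mx sg v) (mxvec E));
      rewrite T0E row_mxKl row_mxKr mxvecK -uE addrC subrK.
  exists (map_mx pi (lsubmx v)).
  by rewrite T0E map_mxD piG addr0 map_mxM piD mul_rV_lin1.
- exact: exT.
- by move=> u; rewrite PTE rpi => /a0.
- move=> z /exT[y ->]; rewrite T1E.
  rewrite map_row_mx map_mxD (rpi _ _ (_ ^T)) piG map_mx0 addr0 map_mxM rD1 mulmx0.
  rewrite map_mxvec map_mxB !map_mxM -map_trmx rD0 rG1 mulmx0 trmx0 mul0mx subrr.
  by rewrite linear0 row_mx0.
- move=> z; rewrite T1E; set u := lsubmx z; set e := vec_mx (lsubmx _).
  set v := vec_mx (rsubmx _); move=> zE.
  have [uE] : u *m D1 + (e *m G0)^T = 0 /\ mxvec (v *m G1 - D0^T *m e) = mxvec 0.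
    by apply: eq_row_mx; rewrite zE linear0 row_mx0.
  move=> /(can_inj mxvecK)/eqP; rewrite subr_eq0 => /eqP vE.
  (* Minimality of F gives residue 0 to [u]. Up to [D1^T *m w], of residue 0, [e] lies in the kernel
     of [G0]; then, up to [D0^T *m x], [v] lies in that of [G1]; minimality of G concludes. *)
  have d1u : d1 (map_mx pi u) = 0.
    move/(congr1 (map_mx pi)): (uE).
    by rewrite map_mxD piG addr0 map_mxM map_mx0 piD mul_rV_lin1.
  have [w wE] : exists w : 'M_(w2, k0), u - map_mx sg (map_mx pi u) = (w *m G0)^T.
    by apply: kerpi; rewrite map_mxB piD subrr.
  have ew0 : (D1^T *m w + e) *m G0 = 0.
    apply: trmx_inj; rewrite mulmxDl linearD /= trmx0 -uE; congr (_ + _).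
    rewrite trE -wE mulmxBl -map_mxM mul_rV_lin1 d1u.
    by rewrite map_mx0 subr0.
  have [x xE] := kerG0 _ _ ew0.
  apply: map_row_mx0; first by rewrite rpi a2.
  have vx0 : (v - D0^T *m x) *m G1 = 0.
    rewrite mulmxBl vE -mulmxA -xE mulmxDr mulmxA -trmx_mul D10 trmx0 mul0mx.
    by rewrite add0r subrr.
  apply: map_row_mx0.
    rewrite -[lsubmx _]vec_mxK -/e map_mxvec.
    have /mG0 := ew0; rewrite map_mxD map_mxM -map_trmx rD1 trmx0 mul0mx add0r => ->.
    by rewrite linear0.
  rewrite -[rsubmx _]vec_mxK -/v map_mxvec.
  have /mG1 := vx0; rewrite map_mxB map_mxM -map_trmx rD0 trmx0 mul0mx subr0 => ->.
  by rewrite linear0.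
Qed.
End Retract.

(** * Fiber products *)

Section KernelIdeal.
Variables (A T : comNzRingType) (a : {rmorphism A -> T}).

(** The kernel again, now as an ideal, hence as a subspace to which [large] can be applied. *)
Definition ker_pred : A -> bool := fun s => a s == 0.
Fact ker_pred_closed : idealr_closed ker_pred.
Proof.
split; rewrite ?unfold_in /ker_pred ?rmorph0 // ?rmorph1 ?oner_eq0 //.
move=> c u v; rewrite !unfold_in => /eqP u0 /eqP v0.
by rewrite rmorphD rmorphM u0 v0 mulr0 addr0.
Qed.
HB.instance Definition _ := isIdealr.Build A ker_pred ker_pred_closed.
Definition ker_ideal : idealr A := ker_pred.
End KernelIdeal.

Lemma quot_eq0 (A : comNzRingType) (I : idealr A) (s : A) :
  (\pi_({ideal_quot I}) s = 0) <-> s \in I.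
Proof.
have -> : (\pi_({ideal_quot I}) s = 0) <-> (\pi_({ideal_quot I}) s = \pi_({ideal_quot I}) 0).
  by rewrite rmorph0.
by rewrite -[X in X \in I]subr0 Quotient.idealrBE; split=> /eqP.
Qed.

(** The first syzygy of [Q] is [kerm a]. The ring [Q] stands for [T] and also for the quotient by
    [ker_ideal a], the form in which [large] presents the same module. *)
Lemma min_pres_ker_quo (A T Q : comNzRingType) (k : fieldType) (rho : {rmorphism A -> k})
    (a : {rmorphism A -> T}) (c : {rmorphism A -> Q}) k0 k1 k2 :
  (forall y, exists s, c s = y) -> (forall s, c s = 0 <-> a s = 0) ->
  (forall s, a s = 0 -> rho s = 0) ->
  min_pres rho (kerm a) k0 k1 k2 -> min_pres rho (restr c Q^o) 1 k0 k1.
Proof.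
move=> csurj cker am; have [q qE] : exists q : {linear kerm a -> A^o}, forall s, q s = val s.
  by apply: linear_of => d u v.
have [p pE] : exists p : {linear A^o -> restr c Q^o}, forall s, p s = c s.
  by apply: linear_of => d u v; rewrite [LHS](rmorphD c); congr (_ + _); exact: (rmorphM c d u).
apply: (min_pres_quo (p := p) (q := q)).
- by move=> y; have [s <-] := csurj y; exists s.
- move=> s; rewrite pE cker; split=> [/eqP s0|[t ->]].
    by exists (Kerm s0).
  by rewrite qE; apply/eqP; exact: (valP t).
- by move=> s; rewrite qE => s0; apply: val_inj.
- by move=> s; rewrite qE; apply/am/eqP; exact: (valP s).
Qed.

Lemma fin_gen_kerm (A T : comNzRingType) (a : {rmorphism A -> T}) :
  noetherian A -> fin_gen (fun _ : kerm a => True).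
Proof.
move=> noeA; pose S (s : A^o) := a s = 0.
have sS : submodule S.
  by split=> [|c u v u0 v0]; rewrite /S ?rmorph0 // rmorphD rmorphM u0 v0 mulr0 addr0.
have /(fin_genP sS)[q [e [Se eS]]] := noeA _ sS.
have Ke i : e i \in kerm_pred a by apply/eqP/Se.
have sT : submodule (fun _ : kerm a => True) by [].
apply/(fin_genP sT); exists q, (fun i => Kerm (Ke i)); split=> // s _.
have [v vE] : exists v, val s = \sum_i v i *: e i by apply/eS/eqP/(valP s).
by exists v; apply: val_inj; rewrite vE raddf_sum.
Qed.

Lemma fin_gen_cyclic (A Q : comNzRingType) (c : {rmorphism A -> Q}) :
  (forall y, exists s, c s = y) -> fin_gen (fun _ : restr c Q^o => True).
Proof.
move=> csurj; have sT : submodule (fun _ : restr c Q^o => True) by [].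
apply/(fin_genP sT); exists 1%N, (fun=> 1 : Q); split=> // y _.
have [s <-] := csurj y; exists (fun=> s); rewrite big_ord1.
by rewrite -[LHS]mulr1.
Qed.

Section FiberProduct.
Variables (A B T : comNzRingType) (k : fieldType).
Variables (a : {rmorphism A -> T}) (b : {rmorphism B -> T}).
Variables (rhoA : {rmorphism A -> k}) (rhoB : {rmorphism B -> k}).
Hypothesis asurj : forall u, exists s, a s = u.
Hypothesis bsurj : forall u, exists t, b t = u.
Hypothesis rhoAB : forall s t, a s = b t -> rhoA s = rhoB t.
Hypotheses (noeA : noetherian A) (noeB : noetherian B).
Hypotheses (locA : is_local rhoA) (locB : is_local rhoB).

Local Notation V := (fiber a b).
Let p1 : {rmorphism V -> A} := @proj1_fun _ _ _ a b.
Let p2 : {rmorphism V -> B} := @proj2_fun _ _ _ a b.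
Let rhoV : {rmorphism V -> k} := rhoA \o p1.

Lemma fiber_mk s t : a s = b t -> exists v : V, p1 v = s /\ p2 v = t.
Proof.
move=> st; have h : (s, t) \in fiber_pred a b by rewrite unfold_in; apply/eqP.
by exists (Fiber h).
Qed.

Lemma fiber_eq (u v : V) : p1 u = p1 v -> p2 u = p2 v -> u = v.
Proof.
move=> e1 e2; apply: val_inj; rewrite [LHS]surjective_pairing [RHS]surjective_pairing.
by congr (_, _).
Qed.

Lemma fiberP (v : V) : a (p1 v) = b (p2 v).
Proof. by case: v => v h; apply/eqP. Qed.

Lemma p1_surj s : exists v, p1 v = s.
Proof. by have [t /esym/fiber_mk[v [<- _]]] := bsurj (a s); exists v. Qed.

Lemma p2_surj t : exists v, p2 v = t.
Proof. by have [s /fiber_mk[v [_ <-]]] := asurj (b t); exists v. Qed.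

Lemma rhoV1 v : rhoA (p1 v) = rhoV v. Proof. by []. Qed.

Lemma rhoV2 v : rhoB (p2 v) = rhoV v.
Proof. by rewrite -rhoV1; apply/esym/rhoAB/fiberP. Qed.

(** The inverses of the two components invert the same element of [T], hence agree there and
    glue. *)
Lemma local_fiber : is_local rhoV.
Proof.
move=> v; rewrite -rhoV1 => /[dup] /locA[s sE].
rewrite rhoV1 -rhoV2 => /locB[t tE].
have st : a s = b t.
  have cs : a s * a (p1 v) = 1 by rewrite -rmorphM mulrC sE rmorph1.
  have ct : a (p1 v) * b t = 1 by rewrite fiberP -rmorphM tE rmorph1.
  by rewrite -[LHS]mulr1 -ct mulrA cs mul1r.
have [w [w1 w2]] := fiber_mk st; exists w.
by apply: fiber_eq; rewrite rmorphM ?w1 ?w2 ?sE ?tE rmorph1.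
Qed.

(** The image of [S] by [p1] is an ideal of [A], and [p2] sends the members killed by [p1] onto an
    ideal of [B], the projections being surjective. Generators of both, lifted to [S], generate
    it. *)
Lemma noetherian_fiber : noetherian V.
Proof.
move=> S sS; have [S0 SD] := sS.
have Slin q (c : 'I_q -> V) (e : 'I_q -> V) : (forall i, S (e i)) -> S (\sum_i c i * e i).
  move=> Se; elim/big_ind: _ => // [x y Sx Sy|i _].
    by have := SD 1 x y Sx Sy; rewrite scale1r.
  by have := SD (c i) (e i) 0 (Se i) S0; rewrite addr0.
pose S1 (s : A^o) := exists v, S v /\ p1 v = s.
pose S2 (t : B^o) := exists v, [/\ S v, p1 v = 0 & p2 v = t].
have sS1 : submodule S1.
  split=> [|c _ _ [u [Su <-]] [v [Sv <-]]]; first by exists 0; rewrite rmorph0.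
  have [c' <-] := p1_surj c; exists (c' * u + v); split; first exact: SD.
  by rewrite rmorphD rmorphM.
have sS2 : submodule S2.
  split=> [|c _ _ [u [Su u1 <-]] [v [Sv v1 <-]]]; first by exists 0; rewrite !rmorph0.
  have [c' <-] := p2_surj c; exists (c' * u + v); split; first exact: SD.
    by rewrite rmorphD rmorphM u1 v1 mulr0 addr0.
  by rewrite rmorphD rmorphM.
have /(fin_genP sS1)[q1 [e1 [Se1 e1S]]] := noeA sS1.
have /(fin_genP sS2)[q2 [e2 [Se2 e2S]]] := noeB sS2.
have /choice[f fP] := Se1; have /choice[g gP] := Se2.
apply/(fin_genP sS).
exists (q1 + q2)%N, (fun i => match split i with inl j => f j | inr j => g j end).
split=> [i|u Su]; first by case: split => j; [case: (fP j)|case: (gP j)].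
have [c1 c1E] : exists c, p1 u = \sum_i c i *: e1 i by apply: e1S; exists u.
have /choice[c1' c1'E] := fun i => p1_surj (c1 i).
pose w := \sum_i c1' i * f i.
have Suw : S (u - w).
  rewrite -[- w]mulN1r addrC; apply: SD => //; apply: Slin => i; by case: (fP i).
have uw1 : p1 (u - w) = 0.
  rewrite rmorphB c1E rmorph_sum -sumrB big1 // => i _.
  by rewrite rmorphM c1'E (fP i).2 subrr.
have [c2 c2E] : exists c, p2 (u - w) = \sum_i c i *: e2 i by apply: e2S; exists (u - w).
have /choice[c2' c2'E] := fun i => p2_surj (c2 i).
exists (fun i => match split i with inl j => c1' j | inr j => c2' j end).
have splitl i : split (lshift q2 i) = inl i := unsplitK (inl i).
have splitr i : split (rshift q1 i) = inr i := unsplitK (inr i).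
rewrite big_split_ord /= -[LHS](subrK w) [LHS]addrC; congr (_ + _).
  by apply: eq_bigr => i _; rewrite splitl.
apply: fiber_eq.
  rewrite uw1 rmorph_sum big1 // => i _; rewrite splitr rmorphM.
  by have [_ -> _] := gP i; rewrite mulr0.
rewrite c2E rmorph_sum; apply: eq_bigr => i _; rewrite splitr rmorphM c2'E.
by have [_ _ ->] := gP i.
Qed.

Lemma ker_inl : exists q : {linear restr p1 (kerm a) -> V^o},
  forall s : kerm a, p1 (q s) = val s /\ p2 (q s) = 0.
Proof.
have /choice[f fP] : forall s : kerm a, exists v, p1 v = val s /\ p2 v = 0.
  by move=> s; apply: fiber_mk; rewrite rmorph0; apply/eqP/(valP s).
have [q qE] : exists q : {linear restr p1 (kerm a) -> V^o}, forall s, q s = f s.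
  apply: linear_of => c u v; apply: fiber_eq; rewrite rmorphD rmorphM; first by rewrite !(fP _).1.
  by rewrite !(fP _).2 mulr0 addr0.
by exists q => s; rewrite qE.
Qed.

Lemma ker_inr : exists q : {linear restr p2 (kerm b) -> V^o},
  forall t : kerm b, p1 (q t) = 0 /\ p2 (q t) = val t.
Proof.
have /choice[f fP] : forall t : kerm b, exists v, p1 v = 0 /\ p2 v = val t.
  by move=> t; apply: fiber_mk; rewrite rmorph0; apply/esym/eqP/(valP t).
have [q qE] : exists q : {linear restr p2 (kerm b) -> V^o}, forall t, q t = f t.
  apply: linear_of => c u v; apply: fiber_eq; rewrite rmorphD rmorphM; last by rewrite !(fP _).2.
  by rewrite !(fP _).1 mulr0 addr0.
by exists q => t; rewrite qE.
Qed.

Section Presentations.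
Variables k0 k1 k2 j0 j1 j2 : nat.
Hypothesis minK : min_pres rhoV (restr p1 (kerm a)) k0 k1 k2.
Hypothesis minJ : min_pres rhoV (restr p2 (kerm b)) j0 j1 j2.

Lemma p2_eq0 (q : {linear restr p1 (kerm a) -> V^o}) :
  (forall s : kerm a, p1 (q s) = val s /\ p2 (q s) = 0) ->
  forall v, p2 v = 0 <-> exists s, v = q s.
Proof.
move=> qE v; split=> [v0|[s ->]]; last exact: (qE s).2.
have v1 : p1 v \in kerm_pred a by rewrite unfold_in fiberP v0 rmorph0.
by exists (Kerm v1); apply: fiber_eq; rewrite ?(qE _).1 ?(qE _).2.
Qed.

Lemma p1_eq0 (q : {linear restr p2 (kerm b) -> V^o}) :
  (forall t : kerm b, p1 (q t) = 0 /\ p2 (q t) = val t) ->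
  forall v, p1 v = 0 <-> exists t, v = q t.
Proof.
move=> qE v; split=> [v0|[s ->]]; last exact: (qE s).1.
have v2 : p2 v \in kerm_pred b by rewrite unfold_in -fiberP v0 rmorph0.
by exists (Kerm v2); apply: fiber_eq; rewrite ?(qE _).1 ?(qE _).2.
Qed.

(** The kernel of [p2] is the copy of [kerm a] formed by the pairs (s, 0), whose resolution is
    shifted by one degree. *)
Lemma min_pres_snd : min_pres rhoV (restr p2 B^o) 1 k0 k1.
Proof.
have [q qE] := ker_inl.
have [p pE] : exists p : {linear V^o -> restr p2 B^o}, forall v, p v = p2 v.
  by apply: linear_of => c u v; rewrite [LHS](rmorphD p2); congr (_ + _).
apply: (min_pres_quo (p := p) (q := q)) minK.
- by move=> t; have [v <-] := p2_surj t; exists v.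
- by move=> v; rewrite pE; exact: p2_eq0.
- by move=> s qs; apply: val_inj; rewrite /= -(qE s).1 qs rmorph0.
- by move=> s; rewrite -rhoV2 (qE s).2 rmorph0.
Qed.

Lemma min_pres_fst : min_pres rhoV (restr p1 A^o) 1 j0 j1.
Proof.
have [q qE] := ker_inr.
have [p pE] : exists p : {linear V^o -> restr p1 A^o}, forall v, p v = p1 v.
  by apply: linear_of => c u v; rewrite [LHS](rmorphD p1); congr (_ + _).
apply: (min_pres_quo (p := p) (q := q)) minJ.
- by move=> s; have [v <-] := p1_surj s; exists v.
- by move=> v; rewrite pE; exact: p1_eq0.
- by move=> s qs; apply: val_inj; rewrite /= -(qE s).2 qs rmorph0.
- by move=> s; rewrite -rhoV1 (qE s).1 rmorph0.
Qed.

(** The kernel of the map from [V] to [Q] is the direct sum of the kernels of [p1] and [p2]: a pair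
    (s, t) in it is (s, 0) + (0, t). *)
Lemma min_pres_common (Q : comNzRingType) (c : {rmorphism A -> Q}) :
  (forall y, exists s, c s = y) -> (forall s, c s = 0 <-> a s = 0) ->
  min_pres rhoV (restr p1 (restr c Q^o)) 1 (k0 + j0) (k1 + j1).
Proof.
move=> csurj cker; have [q1 q1E] := ker_inl; have [q2 q2E] := ker_inr.
pose cp : {rmorphism V -> Q} := c \o p1.
have [p pE] : exists p : {linear V^o -> restr p1 (restr c Q^o)}, forall v, p v = cp v.
  by apply: linear_of => d u v; rewrite [LHS](rmorphD cp); congr (_ + _); exact: (rmorphM cp d u).
apply: (min_pres_cyclic (p := p) (q1 := q1) (q2 := q2)) minK minJ.
- by move=> y; have [s <-] := csurj y; have [v <-] := p1_surj s; exists v.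
- move=> v; rewrite pE; split=> [/cker v0|[s [t ->]]].
    have vK : p1 v \in kerm_pred a by rewrite unfold_in v0.
    exists (Kerm vK); have [t tE] : exists t, v - q1 (Kerm vK) = q2 t.
      by apply/(p1_eq0 q2E); rewrite rmorphB (q1E _).1 subrr.
    by exists t; rewrite -tE addrC subrK.
  apply/cker; rewrite (rmorphD p1) (q1E _).1 (q2E _).1 addr0.
  by apply/eqP; exact: (valP s).
- move=> s t st; split; apply: val_inj => /=.
    by move/(congr1 p1): st; rewrite (rmorphD p1) (q1E s).1 (q2E t).1 addr0 rmorph0.
  by move/(congr1 p2): st; rewrite (rmorphD p2) (q1E s).2 (q2E t).2 add0r rmorph0.
- by move=> s; rewrite -rhoV2 (q1E s).2 rmorph0.
- by move=> s; rewrite -rhoV1 (q2E s).1 rmorph0.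
Qed.

(** Compatibility of [gamma] with the maps to [T] makes t |-> (gamma t, t) a section of [p2], as
    [min_pres_retract] requires. *)
Lemma min_pres_section (M : lmodType B) (gamma : {rmorphism B -> A}) w0 w1 w2 :
  (forall t, a (gamma t) = b t) -> min_pres rhoB M w0 w1 w2 ->
  min_pres rhoV (restr p2 M) w0 (w1 + w0 * k0) (w2 + (w1 * k0 + w0 * k1)).
Proof.
move=> gE minM; have [q qE] := ker_inl.
have /choice[f fP] := fun t => fiber_mk (gE t).
have fB : zmod_morphism f.
  by move=> u v; apply: fiber_eq; rewrite rmorphB ?(fP _).1 ?(fP _).2 ?rmorphB.
have fM : monoid_morphism f.
  by split=> [|u v]; apply: fiber_eq; rewrite ?rmorphM ?rmorph1 ?(fP _).1 ?(fP _).2 ?rmorphM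
    ?rmorph1.
pose sg : {rmorphism B -> V} := HB.pack f
  (GRing.isZmodMorphism.Build B V f fB) (GRing.isMonoidMorphism.Build B V f fM).
apply: (min_pres_retract (sg := sg) (q := q) _ rhoV2 _ _ minM minK).
- by move=> t; exact: (fP t).2.
- by move=> v; exact: p2_eq0.
- by move=> s qs; apply: val_inj; rewrite /= -(qE s).1 qs rmorph0.
Qed.

End Presentations.

Hypothesis reducedT : forall (u : T) p, u ^+ p = 0 -> u = 0.

(** If [k0], [k1] are the first Betti numbers of [kerm a] over [A] and [j0] that of [kerm b] over
    [B], those of [T] in degrees 1 and 2 over [A] are [k0], [k1], and in degree 1 over [B] it is
    [j0]. Either hypothesis gives [k1' = k0 * j0 + k1] for the Betti number [k1'] of [kerm a] over
    [V] in degree 1; the Betti numbers sought are then those of the product of the series of [W] by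
    1, [k0], [k1']. *)
Theorem betti_fiber (W : idealr B) : radical_ideal W ->
  (poincare rhoV (restr p1 (kerm a)) =1
     ps_mul (poincare rhoA (kerm a)) (poincare rhoV (restr p1 A^o)) /\
   exists gamma : {rmorphism B -> A}, forall t, a (gamma t) = b t) \/
  (large rhoV rhoA p1 /\ large rhoV rhoB p2) ->
  [/\ betti rhoV (restr p2 (subsp W)) 0 = betti rhoB (subsp W) 0,
      betti rhoV (restr p2 (subsp W)) 1 =
        (betti rhoB (subsp W) 0 * betti rhoA (restr a T^o) 1 + betti rhoB (subsp W) 1)%N &
      betti rhoV (restr p2 (subsp W)) 2 =
        (betti rhoB (subsp W) 0 * betti rhoB (restr b T^o) 1 * betti rhoA (restr a T^o) 1
         + betti rhoB (subsp W) 0 * betti rhoA (restr a T^o) 2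
         + betti rhoB (subsp W) 1 * betti rhoA (restr a T^o) 1
         + betti rhoB (subsp W) 2)%N].
Proof.
move=> radW hyp.
have aker s : a s = 0 -> rhoA s = 0.
  by move=> s0; rewrite (@rhoAB s 0) ?rmorph0.
have bker t : b t = 0 -> rhoB t = 0.
  by move=> t0; rewrite -(@rhoAB 0 t) ?rmorph0.
have [k0 [k1 [k2 minKA]]] := min_pres_exists noeA locA (fin_gen_kerm a noeA).
have [j0 [j1 [j2 minJB]]] := min_pres_exists noeB locB (fin_gen_kerm b noeB).
have quoW y : exists t, (\pi_({ideal_quot W}) : {rmorphism B -> _}) t = y.
  by exists (repr y); exact: reprK.
have [w0 [w1 [w2 minW]]] := min_pres_exists noeB locB (fin_gen_cyclic quoW).
have minTA := min_pres_ker_quo asurj (fun s => iff_refl _) aker minKA.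
have minTB := min_pres_ker_quo bsurj (fun s => iff_refl _) bker minJB.
have [k1' [k2' minK]] := min_pres_restr noetherian_fiber local_fiber p1_surj rhoV1 minKA.
have [j1' [j2' minJ]] := min_pres_restr noetherian_fiber local_fiber p2_surj rhoV2 minJB.
have [_ TA1 TA2] := betti_min_pres noeA minTA.
have [_ TB1 _] := betti_min_pres noeB minTB.
have [W0 W1 W2] := betti_min_pres noeB minW.
have [K0 K1 _] := betti_min_pres noeA minKA.
have [VK0 VK1 _] := betti_min_pres noetherian_fiber minK.
have [VA0 VA1 VA2] := betti_min_pres noetherian_fiber (min_pres_fst minJ).
have [VB0 VB1 VB2] := betti_min_pres noetherian_fiber (min_pres_snd minK).
rewrite /subsp in W0 W1 W2 *.
rewrite TA1 TA2 TB1 W0 W1 W2.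
case: hyp => [[weak [gamma gE]]|[large1 large2]].
  have [-> -> ->] := betti_min_pres noetherian_fiber (min_pres_section minK gE minW).
  (* In degree 1, weak largeness reads [k1' = k0 * j0 + k1]. *)
  have := weak 1%N; rewrite /ps_mul /poincare !big_ord_recr !big_ord0 /=.
  rewrite VK1 K0 K1 VA0 VA1 => ->; split=> //; lia.
have quoK y : exists s, (\pi_({ideal_quot (ker_ideal a)}) : {rmorphism A -> _}) s = y.
  by exists (repr y); exact: reprK.
have quoK0 s : (\pi_({ideal_quot (ker_ideal a)}) : {rmorphism A -> _}) s = 0 <-> a s = 0.
  by rewrite quot_eq0 unfold_in; split=> /eqP.
have [_ _ VT2] := betti_min_pres noetherian_fiber (min_pres_common minK minJ quoK quoK0).
have [AT0 AT1 AT2] := betti_min_pres noeA (min_pres_ker_quo quoK quoK0 aker minKA).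
have radK : radical_ideal (ker_ideal a).
  move=> s p; rewrite !unfold_in rmorphXn => /eqP/reducedT ->; exact: eqxx.
(* In degree 2, with both sides computed, this reads [k1' + j1' = j1' + k0 * j0 + k1]. *)
have := large1 _ radK 2; rewrite /ps_mul /poincare !big_ord_recr !big_ord0 /= /subsp.
rewrite VT2 AT0 AT1 AT2 VA0 VA1 VA2 => k1'E.
have lW i := large2 _ radW i; move: (lW 0%N) (lW 1%N) (lW 2%N).
rewrite /ps_mul /poincare !big_ord_recr !big_ord0 /= /subsp.
rewrite W0 W1 W2 VB0 VB1 VB2 => -> -> ->.
have -> : k1' = (k0 * j0 + k1)%N by lia.
split; nia.
Qed.

End FiberProduct.

(** * Convergent power series *)

Section Numbers.
Local Open Scope complex_scope.
Variable R : realType.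
Local Notation K := (CC R).

Lemma complex_archi (x C : K) : 0 < x -> 0 <= C -> exists M : nat, C < x * M%:R.
Proof.
case: x C => [x x'] [c c']; rewrite ltcE lecE /= => /andP[/eqP -> x0] /andP[/eqP -> c0].
exists (Num.bound (x^-1 * c)).
have -> : (x +i* 0) * (Num.bound (x^-1 * c))%:R = (x * (Num.bound (x^-1 * c))%:R)%:C :> R[i].
  by rewrite rmorphM rmorph_nat.
rewrite ltcR -ltr_pdivrMl //; apply: archi_boundP.
by rewrite mulr_ge0 ?invr_ge0 // ltW.
Qed.

Lemma archi_eq0 (x C : K) : (forall M : nat, `|x| * M%:R <= C) -> x = 0.
Proof.
move=> h; apply/eqP; apply: contrapT => /negP x0.
have C0 : 0 <= C by apply: le_trans (h 0%N); rewrite mulr0.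
have [|M] := @complex_archi `|x| C _ C0; first by rewrite normr_gt0.
by move=> /(le_lt_trans (h M)); rewrite ltxx.
Qed.

(** Nested intervals: for positive indices, every v_M - C/M is below every v_N + C/N, and [l] is the
    supremum of the former. *)
Lemma real_limit (v : nat -> R) (C : R) :
  (forall M N, (M <= N)%N -> `|v N - v M| * M%:R <= C) ->
  exists l, forall M, `|v M - l| * M%:R <= C.
Proof.
move=> vC; have C0 : 0 <= C by apply: le_trans (vC 0%N 0%N _); rewrite ?mulr0.
pose A := [set y | exists M, y = v M.+1 - C / M.+1%:R]%classic.
have bnd M N : v M.+1 - C / M.+1%:R <= v N.+1 + C / N.+1%:R.
  have m0 k : 0 < k.+1%:R :> R by rewrite ltr0n.
  rewrite lerBlDr -addrA -lerBlDl; apply: le_trans (ler_norm _) _.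
  case: (leqP M N) => [MN|/ltnW NM].
    apply: (@le_trans _ _ (C / M.+1%:R)); last by rewrite lerDr divr_ge0.
    by rewrite ler_pdivlMr // distrC; apply: vC.
  apply: (@le_trans _ _ (C / N.+1%:R)); last by rewrite lerDl divr_ge0.
  by rewrite ler_pdivlMr //; apply: vC.
have A0 : (A !=set0)%classic by exists (v 1%N - C / 1%:R); exists 0%N.
have ubA N : ubound A (v N.+1 + C / N.+1%:R) by move=> _ [M ->]; exact: bnd.
have hA : has_sup A by split=> //; exists (v 1%N + C / 1%:R); exact: ubA.
exists (sup A) => -[|M]; first by rewrite mulr0.
rewrite -ler_pdivlMr ?ltr0n // ler_distlC; apply/andP; split.
  by apply: ub_le_sup; [case: hA|exists M].
by apply: ge_sup => //; exact: ubA.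
Qed.

Lemma complex_limit (u : nat -> K) (C : K) :
  (forall M N, (M <= N)%N -> `|u N - u M| * M%:R <= C) ->
  exists l, forall M, `|u M - l| * M%:R <= C *+ 2.
Proof.
move=> uC; have C0 : 0 <= C by apply: le_trans (uC 0%N 0%N _); rewrite ?mulr0.
have [c CE] : exists c : R, C = c%:C.
  by move: C0; case: (C) => c c'; rewrite lecE /= => /andP[/eqP -> _]; exists c.
have natC (M : nat) : M%:R = (M%:R : R)%:C :> K by rewrite rmorph_nat.
have normI (z : K) : `|complex.Im z|%:C <= `|z| :> K.
  rewrite normc_def lecR -sqrtr_sqr ler_wsqrtr // lerDr; exact: sqr_ge0.
have part (f : K -> R) : (forall x y, f (x - y) = f x - f y) ->
    (forall z, `|f z|%:C <= `|z| :> K) ->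
    exists l : R, forall M, `|f (u M) - l| * M%:R <= c.
  move=> fB fn; apply: real_limit => M N MN; rewrite -lecR rmorphM /= -natC -CE.
  by apply: le_trans (uC _ _ MN); rewrite ler_wpM2r // -fB.
have [l1 h1] := part (@complex.Re R) (fun x y => raddfB _ x y) (@normc_ge_Re R).
have [l2 h2] := part (@complex.Im R) (fun x y => raddfB _ x y) normI.
exists (l1 +i* l2) => M.
have -> : u M - (l1 +i* l2) = (complex.Re (u M) - l1)%:C +
    (0 +i* (complex.Im (u M) - l2)) :> R[i].
  by case: (u M) => x y; apply/eqP; rewrite eq_complex /= !addr0 !add0r !eqxx.
have -> : C *+ 2 = C + C by rewrite mulr2n.
have normi (x : R) : `|0 +i* x| = `|x|%:C :> R[i].
  by rewrite normc_def /= expr0n /= add0r sqrtr_sqr.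
apply: le_trans (_ : (`|complex.Re (u M) - l1|%:C + `|complex.Im (u M) - l2|%:C) * M%:R <= _).
  rewrite ler_wpM2r //; apply: le_trans (ler_normD _ _) _.
  by rewrite normi lerD2r normc_def /= expr0n /= addr0 sqrtr_sqr.
rewrite mulrDl natC -!rmorphM CE; apply: lerD; rewrite lecR; [exact: h1|exact: h2].
Qed.
End Numbers.

(** * Monomials encoded by integers *)

Fixpoint pr i : nat := if i is j.+1 then s2val (prime_above (pr j)) else 2%N.

Lemma pr_prime i : prime (pr i).
Proof. by case: i => //= i; case: prime_above. Qed.

Lemma pr_gt1 i : (1 < pr i)%N.
Proof. exact/prime_gt1/pr_prime. Qed.

Lemma pr_gt0 i : (0 < pr i)%N.
Proof. exact/prime_gt0/pr_prime. Qed.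

Lemma pr_inj : injective pr.
Proof.
apply: incn_inj; apply: leq_mono => i j; elim: j => // j IH.
rewrite ltnS leq_eqVlt => /predU1P[->|/IH ij] /=; first by case: prime_above.
by apply: ltn_trans ij _; case: prime_above.
Qed.

Section Smooth.
Variable n : nat.

(** These are exactly the values of [idx]; 0 and the integers with other prime factors encode no
    monomial. *)
Definition smooth (k : nat) : bool := [pred p | p \in [seq pr i | i <- iota 0 n]].-nat k.

(* The monomial of exponent [nu] is encoded by the number [idx nu]. *)
Definition idx (nu : {ffun 'I_n -> nat}) : nat := (\prod_(i < n) pr i ^ nu i)%N.
Definition expo (k : nat) : {ffun 'I_n -> nat} := [ffun i : 'I_n => logn (pr i) k].

Lemma smooth_gt0 k : smooth k -> (0 < k)%N.
Proof. by case/andP. Qed.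

Lemma smoothM k l : smooth (k * l) = smooth k && smooth l.
Proof. exact: pnatM. Qed.

Lemma smooth1 : smooth 1. Proof. by []. Qed.

Lemma smooth_idx nu : smooth (idx nu).
Proof.
rewrite /idx; elim/big_ind: _ => // [k l kS lS|i _]; first by rewrite smoothM kS.
rewrite /smooth pnatX pnatE ?pr_prime //=; apply/orP; left.
by rewrite inE map_f // mem_iota add0n ltn_ord.
Qed.

Lemma logn_idx nu i : logn (pr i) (idx nu) = if insub i is Some j then nu j else 0%N.
Proof.
have logp (I : finType) (P : pred I) (F : I -> nat) p : (forall i, (0 < F i)%N) ->
    logn p (\prod_(i | P i) F i) = (\sum_(i | P i) logn p (F i))%N.
  move=> F0; suff [] : (0 < \prod_(i | P i) F i)%N /\
     logn p (\prod_(i | P i) F i) = (\sum_(i | P i) logn p (F i))%N by [].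
  elim/big_rec2: _ => [|j x y _ [y0 <-]]; first by rewrite logn1.
  by rewrite muln_gt0 F0 y0 lognM.
rewrite /idx logp => [|j]; last by rewrite expn_gt0 pr_gt0.
under eq_bigr => j _ do rewrite lognX logn_prime ?pr_prime // (inj_eq pr_inj).
case: insubP => [j _ ji|/negP ni].
  rewrite (bigD1 j) //= ji eqxx muln1 big1 ?addn0 // => l lj.
  case: eqP => [il|]; last by rewrite muln0.
  by rewrite -(inj_eq val_inj) /= ji -il eqxx in lj.
rewrite big1 // => j _; case: eqP => [il|]; last by rewrite muln0.
by case: ni; rewrite il.
Qed.

Lemma idxK : cancel idx expo.
Proof.
move=> nu; apply/ffunP => i; rewrite ffunE logn_idx.
by rewrite insubT // => lt; congr (nu _); apply: val_inj.
Qed.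

Lemma expoK k : smooth k -> idx (expo k) = k.
Proof.
move=> kS; apply: eqn_from_log; rewrite ?(smooth_gt0 (smooth_idx _)) ?(smooth_gt0 kS) //.
move=> p; case: (boolP (p \in [seq pr i | i <- iota 0 n])) => [/mapP[j]|np].
  by rewrite mem_iota add0n /= => lt ->; rewrite logn_idx insubT ffunE.
have z l : smooth l -> logn p l = 0%N.
  move=> /pnatPpi lS; apply/eqP; rewrite -leqn0 leqNgt logn_gt0; apply/negP.
  by move=> pl; case/negP: np; exact: (lS p pl).
by rewrite (z _ (smooth_idx _)) (z _ kS).
Qed.

Lemma smooth_dvdn k l : smooth k -> (0 < l)%N ->
  (forall i, (i < n)%N -> (logn (pr i) k <= logn (pr i) l)%N) -> (k %| l)%N.
Proof.
move=> kS l0 h; apply/dvdn_partP => [|p pk]; first exact: smooth_gt0.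
have := pnatPpi kS pk; rewrite inE => /mapP[j]; rewrite mem_iota add0n /= => lt ->.
by rewrite p_part pfactor_dvdn ?pr_prime // h.
Qed.
End Smooth.

Section Monomials.
Variables (R : realType) (n : nat).
Local Notation K := (CC R).
Implicit Types (h : 'rV[K]_n).

(** The value 0 at integers that encode no monomial makes [mon h] multiplicative on all of [nat], so
    that series can be summed over all integers. *)
Definition mon h (k : nat) : K :=
  if smooth n k then \prod_(i < n) h 0 i ^+ logn (pr i) k else 0.

(** At a smooth [k], the value of the monomial on the polyradius p_i^(-s-1). The exponent is never
    0, so that the weight of 0 is 0. *)
Definition wt s (k : nat) : K := k%:R ^- s.+1.

Definition small s h := forall i : 'I_n, `|h 0 i| <= (pr i)%:R ^- s.+1.

Lemma mon0 h : mon h 0 = 0. Proof. by []. Qed.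

Lemma monM h k l : mon h (k * l) = mon h k * mon h l.
Proof.
rewrite /mon smoothM; case: (boolP (smooth n k)) => kS; last by rewrite mul0r.
case: (boolP (smooth n l)) => lS /=; last by rewrite mulr0.
rewrite -big_split; apply: eq_bigr => i _.
by rewrite lognM ?exprD ?(smooth_gt0 kS) ?(smooth_gt0 lS).
Qed.

Lemma mon_idx h nu : mon h (idx nu) = \prod_(i < n) h 0 i ^+ nu i.
Proof.
rewrite /mon smooth_idx; apply: eq_bigr => i _.
by rewrite -{2}(idxK nu) ffunE.
Qed.

Lemma wt_ge0 s k : 0 <= wt s k.
Proof. by rewrite invr_ge0 exprn_ge0. Qed.

Lemma wt_gt0 s k : (0 < k)%N -> 0 < wt s k.
Proof. by move=> k0; rewrite invr_gt0 exprn_gt0 // ltr0n. Qed.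

Lemma wt0 s : wt s 0 = 0.
Proof. by rewrite /wt expr0n invr0. Qed.

Lemma wtM s k l : wt s (k * l) = wt s k * wt s l.
Proof. by rewrite /wt natrM exprMn invfM. Qed.

Lemma wtS s k : wt s.+1 k * k%:R = wt s k.
Proof.
case: k => [|k]; first by rewrite !wt0 mul0r.
by rewrite /wt [in LHS]exprS invfM mulrAC mulVf ?mul1r // pnatr_eq0.
Qed.

Lemma wt_le s s' k : (s <= s')%N -> wt s' k <= wt s k.
Proof.
elim: s' => [|s' IH]; first by rewrite leqn0 => /eqP ->.
rewrite leq_eqVlt => /predU1P[-> //|]; rewrite ltnS => /IH; apply: le_trans.
rewrite -(wtS s'); case: k {IH} => [|k]; first by rewrite wt0 mul0r.
by rewrite ler_peMr ?wt_ge0 // ler1n.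
Qed.

Lemma small_le s s' h : (s <= s')%N -> small s' h -> small s h.
Proof. by move=> le hs i; apply: le_trans (hs i) (wt_le _ le). Qed.

Lemma mon_le s h k : small s h -> `|mon h k| <= wt s k.
Proof.
move=> hs; rewrite /mon; case: ifPn => [kS|_]; last by rewrite normr0 wt_ge0.
rewrite -[in X in _ <= X](expoK kS) /wt /idx natr_prod -prodrXl -prodfV normr_prod.
apply: ler_prod => i _; rewrite normr_ge0 normrX ffunE.
rewrite natrX -exprM mulnC exprM -exprVn lerXn2r ?nnegrE ?invr_ge0 ?exprn_ge0 //.
Qed.

End Monomials.

(** * Division *)

Section WeightedSums.
Variable K : numFieldType.
Implicit Types (a b c u v w : nat -> K).

(** The weighted l^1 norm is at most [C], expressed with partial sums to avoid infinite series. *)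
Definition wbound w (C : K) a : Prop := forall M, \sum_(k < M) `|a k| * w k <= C.

(* Monomials multiply as the numbers encoding them, so this is the product of series. *)
Definition conv u v (m : nat) : K :=
  \sum_(k < m.+1) \sum_(l < m.+1 | (k * l == m)%N) u k * v l.

(** Course-of-values recursion: the value at [m] is stable from iteration [m.+1] of [step] on. *)
Lemma strong_rec (T : Type) (step : (nat -> T) -> nat -> T) (x0 : T) :
  (forall f f' m, (forall k, (k < m)%N -> f k = f' k) -> step f m = step f' m) ->
  exists f, forall m, f m = step f m.
Proof.
move=> loc; pose it i := iter i step (fun=> x0).
have stab m : forall i j, (m < i)%N -> (m < j)%N -> it i m = it j m.
  elim/ltn_ind: m => m IH [|i] [|j] // mi mj /=.
  by apply: loc => k km; apply: IH => //; exact: leq_trans km _.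
exists (fun m => it m.+1 m) => m ; apply: (loc (it m)) => k km.
exact: (stab k m k.+1).
Qed.

(** Forward substitution solves the system. As [B] at most halves weighted norms, each partial sum
    [S] of the norm of the solution satisfies [S <= C + S / 2]. *)
Lemma triangular (B : nat -> nat -> K) w b C :
  (forall k, 0 <= w k) -> (forall k M, \sum_(l < M) `|B k l| * w l <= w k / 2) ->
  wbound w C b ->
  exists2 c, (forall l, c l = b l - \sum_(k < l) c k * B k l) & wbound w (C * 2) c.
Proof.
move=> w0 Bw bC.
have [c cE] : exists c, forall l, c l = b l - \sum_(k < l) c k * B k l.
  apply: (strong_rec 0 (step := fun c l => b l - \sum_(k < l) c k * B k l)) => c c' m cc.
  by congr (_ - _); apply: eq_bigr => k _; rewrite cc.
exists c => // M; set S := \sum_(l < M) _.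
have S2 : S <= C + S / 2.
  apply: (@le_trans _ _ (\sum_(l < M) (`|b l| * w l +
      \sum_(k < M) `|c k| * (`|B k l| * w l)))).
    apply: ler_sum => l _; rewrite cE.
    apply: le_trans (ler_wpM2r (w0 _) (ler_normB _ _)) _.
    rewrite mulrDl lerD2l; apply: le_trans (ler_wpM2r (w0 _) (ler_norm_sum _ _ _)) _.
    rewrite mulr_suml (big_ord_widen M (fun k => `|c k * B k l| * w l)) ?(ltnW (ltn_ord l)) //.
    rewrite big_mkcond; apply: ler_sum => k _; rewrite normrM -mulrA.
    by case: ifP => // _; rewrite !mulr_ge0.
  rewrite big_split /=; apply: lerD; first exact: bC.
  rewrite exchange_big /= /S mulr_suml; apply: ler_sum => k _.
  by rewrite -mulr_sumr -mulrA ler_wpM2l // Bw.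
by rewrite {1}[S]splitr lerD2r ler_pdivrMr // in S2.
Qed.

(** The factors of a positive integer are at most itself, so the range can be enlarged; 0 is set
    apart, being a multiple of 0 by anything. *)
Lemma convE u v M m : (0 < m)%N -> (m < M)%N ->
  conv u v m = \sum_(k < M) \sum_(l < M | (k * l == m)%N) u k * v l.
Proof.
move=> m0 mM; rewrite /conv.
rewrite (big_ord_widen M (fun k => \sum_(l < m.+1 | (k * l == m)%N) u k * v l)) //.
rewrite big_mkcond; apply: eq_bigr => k _.
rewrite (big_ord_widen_cond M (fun l => (k * l == m)%N) (fun l => u k * v l)) //.
case: ifP => [_|/negbT].
  apply: eq_bigl => l; case: eqP => //= kl; rewrite ltnS -kl.
  by rewrite leq_pmull // lt0n; apply: contraTneq m0 => k0; rewrite -kl k0.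
rewrite -leqNgt => mk; rewrite big1 // => l /eqP kl.
by move: mk m0; rewrite -kl; case: (nat_of_ord l) => [|j]; rewrite ?muln0 // => ? _; nia.
Qed.

(** Weights and values of monomials are both such [phi]; [phi 0 = 0] discards the index 0, where
    [conv] depends on the range of summation. *)
Lemma conv_sum (phi : nat -> K) u v M : phi 0 = 0 ->
  (forall k l, phi (k * l)%N = phi k * phi l) ->
  \sum_(m < M) conv u v m * phi m =
  \sum_(k < M) \sum_(l < M | (k * l < M)%N) (u k * phi k) * (v l * phi l).
Proof.
move=> phi0 phiM.
transitivity (\sum_(m < M) \sum_(k < M) \sum_(l < M | (k * l == m)%N)
    (u k * phi k) * (v l * phi l)).
  apply: eq_bigr => -[[|m] mM] _ /=.
    rewrite phi0 mulr0 big1 // => k _; rewrite big1 // => l.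
    rewrite muln_eq0 => /orP[]/eqP ->; rewrite phi0 ?mulr0 ?mul0r //.
  rewrite (@convE _ _ M) // mulr_suml; apply: eq_bigr => k _.
  rewrite mulr_suml; apply: eq_bigr => l /eqP <-.
  by rewrite phiM mulrACA.
rewrite exchange_big; apply: eq_bigr => k _ /=.
rewrite (exchange_big_dep (fun l : 'I_M => (k * l < M)%N)) /=; last by move=> m l _ /eqP ->.
by apply: eq_bigr => l lM; rewrite (big_pred1 (Ordinal lM)).
Qed.

Lemma wbound_conv w u v Cu Cv : (forall k, 0 <= w k) -> w 0%N = 0 ->
  (forall k l, w (k * l)%N = w k * w l) -> wbound w Cu u -> wbound w Cv v ->
  wbound w (Cu * Cv) (conv u v).
Proof.
move=> w_ge0 w0 wM uC vC M.
apply: (@le_trans _ _ (\sum_(m < M) conv (fun k => `|u k|) (fun l => `|v l|) m * w m)).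
  apply: ler_sum => m _; rewrite ler_wpM2r //.
  apply: le_trans (ler_norm_sum _ _ _) _; apply: ler_sum => k _.
  apply: le_trans (ler_norm_sum _ _ _) _; apply: ler_sum => l _.
  by rewrite normrM.
rewrite conv_sum //; apply: (@le_trans _ _ ((\sum_(k < M) `|u k| * w k) * \sum_(l < M) `|v l| * w
  l)).
  rewrite mulr_suml; apply: ler_sum => k _; rewrite mulr_sumr big_mkcond.
  by apply: ler_sum => l _; case: ifP => _; rewrite // !mulr_ge0.
by apply: ler_pM => //; apply: sumr_ge0 => k _; rewrite mulr_ge0.
Qed.

Lemma wboundD w u v (z : K) Cu Cv : (forall k, 0 <= w k) -> wbound w Cu u -> wbound w Cv v ->
  wbound w (`|z| * Cu + Cv) (fun k => z * u k + v k).
Proof.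
move=> w_ge0 uC vC M; apply: le_trans (lerD (ler_wpM2l (normr_ge0 z) (uC M)) (vC M)).
rewrite mulr_sumr -big_split; apply: ler_sum => k _ /=.
by rewrite mulrA -mulrDl ler_wpM2r // -normrM ler_normD.
Qed.

Lemma reindex_mult (F : nat -> K) nu L M : (0 < nu)%N -> (L <= M)%N ->
  \sum_(k < L | (nu %| k)%N) F (k %/ nu)%N = \sum_(m < M | (m * nu < L)%N) F m.
Proof.
move=> nu0 LM.
transitivity (\sum_(k < L) \sum_(m < M | (m * nu == k)%N) F m).
  rewrite big_mkcond; apply: eq_bigr => k _; case: ifPn => [nuk|nnuk].
    have kM : (k %/ nu < M)%N by apply: leq_ltn_trans (leq_div _ _) (leq_trans _ LM).
    rewrite (big_pred1 (Ordinal kM)) // => m; by rewrite -{1}(divnK nuk) eqn_pmul2r.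
  by rewrite big1 // => m /eqP mk; rewrite -mk dvdn_mull in nnuk.
rewrite (exchange_big_dep (fun m : 'I_M => (m * nu < L)%N)) /=; last by move=> k m _ /eqP ->.
by apply: eq_bigr => m mL; rewrite (big_pred1 (Ordinal mL)).
Qed.

Section Division.
Variables (p : nat) (a : 'I_p -> nat -> K) (nu : 'I_p -> nat) (w : nat -> K).
Hypotheses (w_gt0 : forall k, (0 < k)%N -> 0 < w k) (w0 : w 0%N = 0)
  (wM : forall k l, w (k * l)%N = w k * w l).
Hypotheses (nu_gt0 : forall i, (0 < nu i)%N) (a_lead : forall i, a i (nu i) = 1)
  (a_low : forall i k, (k < nu i)%N -> a i k = 0)
  (a_tail : forall i M, \sum_(k < M | (nu i < k)%N) `|a i k| * w k <= w (nu i) / 2).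

Let w_ge0 k : 0 <= w k.
Proof. by case: k => [|k]; [rewrite w0|rewrite ltW // w_gt0]. Qed.

(** Each multiple of an initial monomial is charged to one generator, whichever [pick] finds; the
    other indices are left to the remainder. *)
Let asg k : option 'I_p := [pick i | (nu i %| k)%N].

Let asgP k i : asg k = Some i -> (nu i %| k)%N.
Proof. by rewrite /asg; case: pickP => // j jk [<-]. Qed.

Let tail i mu l : K := \sum_(k < l.+1 | (mu * k == l)%N && (nu i < k)%N) a i k.

(* The coefficients of the tail of the multiple of a generator whose initial
   monomial is [k], when there is one. *)
Let B k l := if asg k is Some i then tail i (k %/ nu i) l else 0.

Let B_bound k M : \sum_(l < M) `|B k l| * w l <= w k / 2.
Proof.
rewrite /B; case asgk: (asg k) => [i|]; last first.
  by rewrite big1 ?divr_ge0 // => l _; rewrite normr0 mul0r.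
rewrite -[in leRHS](divnK (asgP asgk)); set mu := (k %/ nu i)%N; rewrite wM -mulrA.
apply: (@le_trans _ _ (w mu * \sum_(j < M | (nu i < j)%N) `|a i j| * w j)); last first.
  by rewrite ler_wpM2l.
apply: (@le_trans _ _ (\sum_(l < M) \sum_(j < M | (nu i < j)%N && (mu * j == l)%N)
    w mu * (`|a i j| * w j))).
  apply: ler_sum => l _; rewrite /tail.
  apply: le_trans (ler_wpM2r (w_ge0 _) (ler_norm_sum _ _ _)) _.
  rewrite mulr_suml (big_ord_widen_cond M (fun j => (mu * j == l)%N && (nu i < j)%N)
    (fun j => `|a i j| * w l)) //.
  rewrite big_mkcond [leRHS]big_mkcond; apply: ler_sum => j _.
  case: ifP => [/andP[/andP[/eqP jl ->] _]|_]; last by case: ifP; rewrite // !mulr_ge0.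
  by rewrite jl eqxx /= -jl wM mulrCA.
rewrite (exchange_big_dep (fun j : 'I_M => (nu i < j)%N)) /=; last by move=> l j _ /andP[].
rewrite mulr_sumr; apply: ler_sum => j ij; rewrite ij /=.
case: (ltnP (mu * j) M) => jM.
  by rewrite (big_pred1 (Ordinal jM)) //.
by rewrite big1 ?mulr_ge0 // => l /eqP jl; have := ltn_ord l; rewrite -jl ltnNge jM.
Qed.

(** The solution [e] of the triangular system holds quotients and remainder together: at an index
    charged to [i] it is a coefficient of [q i], at a free index one of [c]. In the sum of the
    products, initial terms rebuild the charged part of [e] and tails give the sum of the
    [e k * B k l]; with [c] the total is [b]. *)
Lemma division_coef b C : wbound w C b ->
  exists q c D, [/\ forall i, wbound w D (q i), wbound w D c,
     forall i l, (nu i %| l)%N -> c l = 0 &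
     forall l, (0 < l)%N -> b l = \sum_i conv (q i) (a i) l + c l].
Proof.
move=> bC; have [e eE eC] := triangular w_ge0 B_bound bC.
pose q i mu := if asg (mu * nu i)%N == Some i then e (mu * nu i)%N else 0.
pose c l := if asg l is Some _ then 0 else e l.
have C0 : 0 <= C by apply: le_trans (bC 0%N); rewrite big_ord0.
(* Division by the monomial [nu i] multiplies norms by at most the inverse of [w (nu i)]; [D]
   dominates all these bounds and that of [c]. *)
pose D := C * 2 + \sum_i C * 2 / w (nu i).
have D0 i : C * 2 / w (nu i) <= D.
  rewrite /D (bigD1 i) //= addrCA lerDl addr_ge0 ?mulr_ge0 ?sumr_ge0 // => j _.
  by rewrite !mulr_ge0 ?invr_ge0.
exists q, c, D; split.
- move=> i M; apply: le_trans (D0 i); rewrite ler_pdivlMr ?w_gt0 //.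
  apply: le_trans (eC (M * nu i)%N); rewrite mulr_suml.
  apply: (@le_trans _ _ (\sum_(m < M * nu i | (m * nu i < M * nu i)%N) `|e (m * nu i)%N| * w (m *
    nu i)%N)).
    rewrite (big_ord_widen (M * nu i) (fun k => `|q i k| * w k * w (nu i))) ?leq_pmulr //.
    rewrite big_mkcond [leRHS]big_mkcond; apply: ler_sum => m _.
    rewrite ltn_pmul2r //; case: ifP => // _; rewrite -mulrA -wM ler_wpM2r //.
    by rewrite /q; case: ifP => // _; rewrite normr0.
  rewrite -(reindex_mult (fun m => `|e (m * nu i)%N| * w (m * nu i)%N)) //.
  rewrite big_mkcond; apply: ler_sum => k _; case: ifP => [ik|_]; last by rewrite mulr_ge0.
  by rewrite divnK.
- move=> M; apply: (@le_trans _ _ (C * 2)); last first.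
    by rewrite lerDl sumr_ge0 // => i _; rewrite !mulr_ge0 ?invr_ge0.
  apply: le_trans (eC M); apply: ler_sum => l _; rewrite ler_wpM2r // /c.
  by case: (asg l) => // _; rewrite normr0.
- move=> i l il; rewrite /c /asg; case: pickP => // /(_ i).
  by rewrite il.
move=> l l0.
have convq i : conv (q i) (a i) l =
    (if asg l == Some i then e l else 0) + \sum_(mu < l.+1) q i mu * tail i mu l.
  have split_mu (k : 'I_l.+1) : \sum_(j < l.+1 | (k * j == l)%N) q i k * a i j =
      (if (k * nu i == l)%N then q i k else 0) + q i k * tail i k l.
    rewrite (bigID (fun j : 'I_l.+1 => (nu i < j)%N)) /= addrC /tail mulr_sumr; congr (_ + _).
    case: eqP => kl; last first.
      rewrite big1 // => j /andP[/eqP kj]; rewrite -leqNgt leq_eqVlt => /predU1P[jn|/a_low ->].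
        by case: kl; rewrite -jn.
      by rewrite mulr0.
    have nul : (nu i < l.+1)%N.
      by rewrite ltnS -kl leq_pmull // lt0n; apply: contraTneq l0 => k0; rewrite -kl k0.
    rewrite (bigD1 (Ordinal nul)) /=; last by rewrite kl eqxx ltnn.
    rewrite a_lead mulr1 big1 ?addr0 // => j /andP[/andP[_ ij] jn].
    rewrite a_low ?mulr0 // ltn_neqAle leqNgt ij andbT.
    by apply: contraNneq jn => jn; apply/eqP/val_inj.
  rewrite /conv; under eq_bigr => k _ do rewrite split_mu.
  rewrite big_split /=; congr (_ + _); rewrite -big_mkcond.
  case: (boolP (nu i %| l)%N) => [il|nil].
    have kl : (l %/ nu i < l.+1)%N by rewrite ltnS leq_div.
    rewrite (big_pred1 (Ordinal kl)) => [|k]; first by rewrite /q /= divnK.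
    by rewrite -{2}(divnK il) eqn_pmul2r.
  rewrite big1 => [|k /eqP kl]; last by rewrite -kl dvdn_mull in nil.
  by case: eqP => // /asgP; rewrite (negPf nil).
under eq_bigr => i _ do rewrite convq.
rewrite big_split /=.
have -> : \sum_i (if asg l == Some i then e l else 0) = e l - c l.
  rewrite /c; case: (asg l) => [i|]; last by rewrite subrr big1.
  by rewrite subr0 -big_mkcond (big_pred1 i) // => j; rewrite eq_sym.
(* The tails are regrouped by [k = mu * nu i]. A tail starts strictly after the initial monomial, so
   only [k < l] contributes: this is the triangularity of the system. *)
have -> : \sum_i \sum_(mu < l.+1) q i mu * tail i mu l = \sum_(k < l) e k * B k l.
  transitivity (\sum_i \sum_(k < l) if asg k == Some i then e k * tail i (k %/ nu i) l else 0).
    apply: eq_bigr => i _.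
    transitivity (\sum_(mu < l.+1 | (mu * nu i < l)%N) q i mu * tail i mu l).
      rewrite [RHS]big_mkcond; apply: eq_bigr => mu _; case: ltnP => // lmu.
      rewrite /tail big1 ?mulr0 // => j /andP[/eqP mj ij].
      have mu0 : (0 < mu)%N by rewrite lt0n; apply: contraTneq l0 => m0; rewrite -mj m0.
      by move: lmu; rewrite -[X in (X <= _)%N]mj leq_pmul2l // leqNgt ij.
    rewrite -(reindex_mult (fun mu => q i mu * tail i mu l)) //.
    rewrite big_mkcond; apply: eq_bigr => k _; case: ifPn => [ik|nik].
      by rewrite /q divnK //; case: ifP => // _; rewrite mul0r.
    by case: eqP => // /asgP; rewrite (negPf nik).
  rewrite exchange_big; apply: eq_bigr => k _ /=; rewrite /B.
  case: (asg k) => [i|]; last by rewrite mulr0 big1.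
  by rewrite -big_mkcond (big_pred1 i) // => j; rewrite eq_sym.
by rewrite addrAC subrK [in RHS]eE subrK.
Qed.

End Division.
End WeightedSums.

(** * Functions represented by series over the integers *)

Section Representation.
Variables (R : realType) (n : nat) (x : 'rV[CC R]_n).
Local Notation K := (CC R).
Implicit Types (a b c : nat -> K) (f g : 'rV[K]_n -> K) (h : 'rV[K]_n).

Definition psum a h M : K := \sum_(k < M) a k * mon h k.

(* The rate of convergence 1/M comes for free on a smaller polydisc, since
   [wt s.+1 k * k = wt s k]. *)
Definition rep_with s (C : K) a f : Prop :=
  wbound (@wt R s) C a /\
  forall h, small s h -> forall M, `|psum a h M - f (x + h)| * M%:R <= C.

Definition rep a f : Prop := exists s C, rep_with s C a f.

Lemma wbound_ge0 (w : nat -> K) C a : wbound w C a -> 0 <= C.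
Proof. by move=> aC; apply: le_trans (aC 0%N); rewrite big_ord0. Qed.

Lemma wbound_wt_le s s' C a : (s <= s')%N -> wbound (@wt R s) C a -> wbound (@wt R s') C a.
Proof.
move=> le aC M; apply: le_trans (aC M); apply: ler_sum => k _.
by rewrite ler_wpM2l // wt_le.
Qed.

Lemma rep_with_le s s' C C' a f : (s <= s')%N -> C <= C' ->
  rep_with s C a f -> rep_with s' C' a f.
Proof.
move=> ss CC' [aC af]; split=> [M|h hs M].
  by apply: le_trans CC'; exact: wbound_wt_le aC M.
by apply: le_trans CC'; apply: af; exact: small_le hs.
Qed.

Lemma psum_le s C a h : small s h -> wbound (@wt R s) C a -> forall M, `|psum a h M| <= C.
Proof.
move=> hs aC M; apply: le_trans (aC M); apply: le_trans (ler_norm_sum _ _ _) _.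
by apply: ler_sum => k _; rewrite normrM ler_wpM2l // mon_le.
Qed.

Lemma mon_tail s h k M : small s.+1 h -> (M <= k)%N -> `|mon h k| * M%:R <= wt R s k.
Proof.
move=> hs Mk; rewrite -wtS; apply: ler_pM => //; first exact: mon_le.
by rewrite ler_nat.
Qed.

Lemma rep_common a f b g : rep a f -> rep b g ->
  exists s C, rep_with s C a f /\ rep_with s C b g.
Proof.
move=> [s [C af]] [t [D bg]]; exists (maxn s t), (C + D); split.
  by apply: rep_with_le af; rewrite ?leq_maxl // lerDl; exact: wbound_ge0 bg.1.
by apply: rep_with_le bg; rewrite ?leq_maxr // lerDr; exact: wbound_ge0 af.1.
Qed.

Lemma rep_linear (z : K) a f b g : rep a f -> rep b g ->
  rep (fun k => z * a k + b k) (fun y => z * f y + g y).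
Proof.
move=> af bg; have [s [C [[aC af'] [bC bg']]]] := rep_common af bg.
exists s, (`|z| * C + C); split=> [|h hs M].
  by apply: wboundD => // k; exact: wt_ge0.
have -> : psum (fun k => z * a k + b k) h M = z * psum a h M + psum b h M.
  by rewrite mulr_sumr -big_split; apply: eq_bigr => k _; rewrite mulrDl mulrA.
rewrite opprD addrACA -mulrBr; apply: le_trans (ler_wpM2r _ (ler_normD _ _)) _ => //.
by rewrite mulrDl normrM -mulrA lerD ?ler_wpM2l ?af' ?bg'.
Qed.

Lemma rep0 : rep (fun=> 0) (fun=> 0).
Proof.
exists 0%N, 0; split=> [M|h _ M]; first by rewrite big1 // => k _; rewrite normr0 mul0r.
by rewrite /psum big1 ?subrr ?normr0 ?mul0r // => k _; rewrite mul0r.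
Qed.

Lemma rep_sum p (u : 'I_p -> nat -> K) (F : 'I_p -> 'rV[K]_n -> K) :
  (forall i, rep (u i) (F i)) ->
  rep (fun k => \sum_i u i k) (fun y => \sum_i F i y).
Proof.
elim: p u F => [|p IH] u F uF.
  have -> : (fun k => \sum_(i < 0) u i k) = (fun=> 0) by apply/funext => k; rewrite big_ord0.
  have -> : (fun y => \sum_(i < 0) F i y) = (fun=> 0) by apply/funext => k; rewrite big_ord0.
  exact: rep0.
have := rep_linear 1 (uF ord0) (IH _ _ (fun i => uF (lift ord0 i))).
by congr rep; apply/funext => k; rewrite big_ord_recl mul1r.
Qed.

(** The product of the partial sums up to [M] exceeds that of [conv] by the terms with k * l >= M,
    which are O(1/M) on the polydisc of [s.+1]; the two other errors are that of one factor times a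
    bounded quantity. *)
Lemma rep_conv a f b g : rep a f -> rep b g -> rep (conv a b) (fun y => f y * g y).
Proof.
move=> af bg; have [s [C [[aC af'] [bC bg']]]] := rep_common af bg.
have C0 := wbound_ge0 aC; have CC0 : 0 <= C * C by rewrite mulr_ge0.
exists s.+1, (C * C + (C * C + C * C)); split=> [|h hs M].
  apply: (@wbound_wt_le s) => // M.
  apply: le_trans (wbound_conv (wt_ge0 R s) (wt0 R s) (wtM R s) aC bC M) _.
  by rewrite lerDl addr_ge0.
have hs' := small_le (leqnSn s) hs.
(* This is the case [M = 1], where the partial sum has only the index 0 and vanishes. *)
have fC : `|f (x + h)| <= C.
  have := af' _ hs' 1%N.
  by rewrite /psum big_ord1 mon0 mulr0 sub0r normrN mulr1.
have -> : psum (conv a b) h M - f (x + h) * g (x + h) =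
   - (psum a h M * psum b h M - psum (conv a b) h M)
   + ((psum a h M - f (x + h)) * psum b h M + f (x + h) * (psum b h M - g (x + h))).
  by ring.
apply: le_trans (ler_wpM2r _ (ler_normD _ _)) _ => //; rewrite mulrDl; apply: lerD.
  have -> : psum (conv a b) h M =
      \sum_(k < M) \sum_(l < M | (k * l < M)%N) (a k * mon h k) * (b l * mon h l).
    by apply: conv_sum; [exact: mon0|exact: monM].
  rewrite normrN.
  rewrite /psum mulr_suml -sumrB.
  apply: le_trans (_ : (\sum_(k < M) `|a k| * wt R s k) * (\sum_(l < M) `|b l| * wt R s l) <= _).
    rewrite mulr_suml; apply: le_trans (ler_wpM2r _ (ler_norm_sum _ _ _)) _ => //.
    rewrite mulr_suml; apply: ler_sum => k _; rewrite !mulr_sumr.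
    rewrite (bigID (fun l : 'I_M => (k * l < M)%N)) /= addrAC subrr add0r.
    apply: le_trans (ler_wpM2r _ (ler_norm_sum _ _ _)) _ => //.
    rewrite mulr_suml big_mkcond; apply: ler_sum => l _; rewrite -leqNgt.
    case: ifPn => [kl|_]; last by rewrite !mulr_ge0 ?wt_ge0.
    rewrite !normrM mulrACA -!mulrA; apply: ler_wpM2l => //.
    rewrite [leRHS]mulrCA; apply: ler_wpM2l => //.
    by rewrite mulrA -normrM -monM -wtM; apply: mon_tail.
  apply: ler_pM => //; apply: sumr_ge0 => k _; rewrite mulr_ge0 ?wt_ge0 //.
apply: le_trans (ler_wpM2r _ (ler_normD _ _)) _ => //; rewrite mulrDl !normrM; apply: lerD.
  by rewrite mulrAC ler_pM ?mulr_ge0 // ?af' // (psum_le hs').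
by rewrite -mulrA ler_pM ?mulr_ge0 ?bg'.
Qed.

Lemma psum_tail s C a h M N : small s.+1 h -> wbound (@wt R s) C a -> (M <= N)%N ->
  `|psum a h N - psum a h M| * M%:R <= C.
Proof.
move=> hs aC MN; apply: le_trans (aC N).
rewrite /psum (@big_ord_widen _ _ _ M N (fun k => a k * mon h k)) // (bigID (fun k : 'I_N => (k <
  M)%N)) /=.
rewrite addrAC subrr add0r; apply: le_trans (ler_wpM2r _ (ler_norm_sum _ _ _)) _ => //.
rewrite mulr_suml big_mkcond; apply: ler_sum => k _; rewrite -leqNgt.
case: ifPn => [Mk|_]; last by rewrite mulr_ge0 ?wt_ge0.
by rewrite normrM -mulrA ler_wpM2l // mon_tail.
Qed.

(** On the next smaller polydisc the partial sums are Cauchy at rate 1/M; the function is their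
    limit there and 0 elsewhere. *)
Lemma rep_exists s C a : wbound (@wt R s) C a -> exists f, rep a f.
Proof.
move=> aC; have C0 := wbound_ge0 aC.
have /choice[f fP] : forall h, exists l, small s.+1 h ->
    forall M, `|psum a h M - l| * M%:R <= C *+ 2.
  move=> h; have [hs|nh] := pselect (small s.+1 h); last by exists 0.
  have [l lP] := complex_limit (fun M N MN => psum_tail hs aC MN).
  by exists l.
exists (fun y => f (y - x)), s.+1, (C *+ 2); split=> [M|h hs M].
  apply: le_trans (wbound_wt_le (leqnSn s) aC M) _.
  by rewrite mulr2n lerDl.
have -> : x + h - x = h by rewrite addrAC subrr add0r.
exact: fP.
Qed.

Lemma rep_unique a f b g : (forall k, smooth n k -> a k = b k) -> rep a f -> rep b g ->
  exists s, forall h, small s h -> f (x + h) = g (x + h).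
Proof.
move=> ab af bg; have [s [C [[aC af'] [bC bg']]]] := rep_common af bg.
exists s => h hs; apply/eqP; rewrite -subr_eq0; apply/eqP.
apply: (@archi_eq0 _ _ (C + C)) => M.
have E : psum a h M = psum b h M.
  apply: eq_bigr => k _; rewrite /mon; case: ifP => [/ab ->//|_].
  by rewrite !mulr0.
have -> : f (x + h) - g (x + h) =
   - (psum a h M - f (x + h)) + (psum b h M - g (x + h)).
  by rewrite opprB E addrA subrK.
apply: le_trans (ler_wpM2r _ (ler_normD _ _)) _ => //; rewrite mulrDl normrN.
by apply: lerD; [exact: af'|exact: bg'].
Qed.

(** The sum does not see the coefficients at non-smooth indices; once they are erased, a first
    nonzero coefficient sits at a monomial. *)
Lemma rep_smooth a f : rep a f -> rep (fun k => if smooth n k then a k else 0) f.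
Proof.
move=> [s [C [aC af]]]; exists s, C; split=> [M|h hs M].
  apply: le_trans (aC M); apply: ler_sum => k _; rewrite ler_wpM2r ?wt_ge0 //.
  by case: ifP => // _; rewrite normr0.
rewrite (_ : psum _ h M = psum a h M) ?af //; apply: eq_bigr => k _.
by rewrite /mon; case: ifP => // _; rewrite !mulr0.
Qed.

Lemma rep_base a f : rep a f -> f x = a 1%N.
Proof.
move=> [s [C [aC af]]]; have hs : small s (0 : 'rV[K]_n).
  by move=> i; rewrite mxE normr0; exact: wt_ge0.
apply/eqP; rewrite eq_sym -subr_eq0; apply/eqP; apply: (@archi_eq0 _ _ C) => M.
have := af _ hs M.+2; rewrite addr0.
have -> : psum a 0 M.+2 = a 1%N.
  rewrite /psum !big_ord_recl big1 => [|k _].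
    rewrite mon0 mulr0 add0r addr0 /mon smooth1 big1 ?mulr1 // => i _.
    by rewrite /= logn1 expr0.
  rewrite /mon; case: ifP => [kS|_]; last by rewrite mulr0.
  have [i ki] : exists i : 'I_n, (0 < logn (pr i) (bump 0 (bump 0 k)))%N.
    apply: contrapT => ni; have := expoK kS; rewrite /idx big1 // => i _.
    rewrite ffunE; case: (posnP (logn (pr i) (bump 0 (bump 0 k)))) => [->//|ki].
    by case: ni; exists i.
  rewrite (bigD1 i) //= mxE expr0n; case: eqP ki => [-> //|_ _].
  by rewrite mul0r mulr0.
by apply: le_trans; rewrite ler_wpM2l // ler_nat; lia.
Qed.

End Representation.

(** Bernoulli's inequality (1 + 1/m)^t >= 1 + t/m, cleared of denominators. *)
Lemma bernoulli_nat m t : ((m + t) * m ^ t <= m * m.+1 ^ t)%N.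
Proof.
elim: t => [|t IH]; first by rewrite addn0 !expn0.
rewrite !expnS; have := leq_mul (leqnn m.+1) IH.
move: (m ^ t)%N (m.+1 ^ t)%N => u v; nia.
Qed.

Lemma exp_dominates d m t : (0 < m)%N -> (d * m <= t)%N -> (d * m ^ t <= m.+1 ^ t)%N.
Proof.
move=> m0 dt; rewrite -(leq_pmul2l m0) mulnA; apply: leq_trans (bernoulli_nat m t);
  rewrite leq_mul2r.
by apply/orP; right; lia.
Qed.

Section Seqs.
Variable K : numFieldType.

Lemma sum_sub_seq (s1 s2 : seq nat) (F : nat -> K) : uniq s1 -> uniq s2 ->
  {subset s1 <= s2} -> (forall k, 0 <= F k) -> \sum_(k <- s1) F k <= \sum_(k <- s2) F k.
Proof.
move=> u1 u2 s12 F0; rewrite [leRHS](bigID (fun k => k \in s1)) /=.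
have -> : \sum_(k <- s1) F k = \sum_(k <- s2 | k \in s1) F k.
  rewrite -[RHS]big_filter; apply: perm_big; apply: uniq_perm; rewrite ?filter_uniq // => k.
  by rewrite mem_filter; case: (boolP (k \in s1)) => // /s12 ->.
by rewrite lerDl sumr_ge0.
Qed.

Lemma sum_seq_ord (s : seq nat) (F : nat -> K) L : uniq s -> {in s, forall k, (k < L)%N} ->
  \sum_(k <- s) F k = \sum_(k < L | (k : nat) \in s) F k.
Proof.
move=> us sL; rewrite -(big_mkord (fun k => k \in s)) -[RHS]big_filter.
apply: perm_big; apply: uniq_perm; rewrite ?filter_uniq ?iota_uniq // => k.
rewrite mem_filter mem_index_iota /=; case: (boolP (k \in s)) => // /sL ->.
by [].
Qed.
End Seqs.

(** * Representation of holomorphic functions *)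

Section Holomorphic.
Local Open Scope classical_set_scope.
Variables (R : realType) (n : nat) (x : 'rV[CC R]_n).
Local Notation K := (CC R).
Implicit Types (a b c : nat -> K) (f g : 'rV[K]_n -> K) (h : 'rV[K]_n).

Lemma wtD s t k : wt R (s + t) k = wt R s k * k%:R ^- t.
Proof. by rewrite /wt -addSn exprD invfM. Qed.

(** From [s0] to s0 + t the weight of k is divided by k^t. For k > nu this is at least (nu + 1)^t,
    which outgrows nu^t by any given factor. *)
Lemma tail_small s0 C a nu : wbound (@wt R s0) C a -> (0 < nu)%N ->
  exists s1, forall s, (s1 <= s)%N -> forall M,
    \sum_(k < M | (nu < k)%N) `|a k| * wt R s k <= wt R s nu / 2.
Proof.
move=> aC nu0; have C0 := wbound_ge0 aC.
have [d dC] : exists d : nat, C * 2 * nu%:R ^+ s0.+1 < d%:R.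
  have [|d] := @complex_archi R 1 (C * 2 * nu%:R ^+ s0.+1) ltr01.
    by rewrite !mulr_ge0 ?exprn_ge0.
  by rewrite mul1r; exists d.
(* The factor to beat is 2 C nu^(s0+1), which is below [d]; [exp_dominates] reaches it from t = d nu
   on. *)
exists (s0 + d * nu)%N => s ss M; pose t := (s - s0)%N.
have -> : s = (s0 + t)%N by rewrite subnKC //; apply: leq_trans ss; exact: leq_addr.
have td : (d * nu <= t)%N by rewrite leq_subRL //; apply: leq_trans ss; exact: leq_addr.
apply: (@le_trans _ _ (C * nu.+1%:R ^- t)).
  apply: le_trans (ler_wpM2r _ (aC M)); last by rewrite invr_ge0 exprn_ge0.
  rewrite mulr_suml big_mkcond; apply: ler_sum => k _; case: ifP => [nuk|_]; last first.
    by rewrite !mulr_ge0 ?wt_ge0 ?invr_ge0 ?exprn_ge0.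
  rewrite wtD -!mulrA ler_wpM2l // ler_wpM2l ?wt_ge0 //.
  rewrite lef_pV2 ?posrE ?exprn_gt0 ?ltr0n //; last by apply: leq_trans nuk.
  by rewrite lerXn2r ?nnegrE // ler_nat.
rewrite wtD /wt; have nuK : 0 < nu%:R :> K by rewrite ltr0n.
have : C * 2 * nu%:R ^+ s0.+1 * nu%:R ^+ t <= nu.+1%:R ^+ t.
  apply: (@le_trans _ _ (d%:R * nu%:R ^+ t)).
    by rewrite ler_wpM2r ?exprn_ge0 // ltW.
  by rewrite -!natrX -natrM ler_nat exp_dominates.
have : 0 < nu.+1%:R ^+ t :> K by rewrite exprn_gt0 // ltr0n.
have : 0 < nu%:R ^+ t :> K by rewrite exprn_gt0.
have : 0 < nu%:R ^+ s0.+1 :> K by rewrite exprn_gt0.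
move: ((nu%:R : K) ^+ s0.+1) ((nu%:R : K) ^+ t) ((nu.+1%:R : K) ^+ t) => u v z u0 v0 z0 le.
rewrite ler_pdivrMr //.
have -> : C = (C * 2 * u * v) * (u^-1 * v^-1 / 2).
  by field; rewrite !lt0r_neq0.
by rewrite mulrC ler_wpM2l // !mulr_ge0 ?invr_ge0 // ltW.
Qed.

(* The numbers encoding the monomials of the box [0, N[^n. *)
Definition box_idx N : seq nat := [seq idx (midx nu) | nu : {ffun 'I_n -> 'I_N}].

Lemma box_idx_uniq N : uniq (box_idx N).
Proof.
rewrite map_inj_uniq ?enum_uniq // => u v /(can_inj (@idxK n))/ffunP e; apply/ffunP => i.
by apply: val_inj; move: (e i); rewrite !ffunE.
Qed.

(** Exponents in the factorization of [k] are less than [k]. Hence a box sum and the partial sum up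
    to [N] differ only by indices at least [N]. *)
Lemma mem_box_idx N k : smooth n k -> (k < N)%N -> k \in box_idx N.
Proof.
move=> kS kN; have lt (i : 'I_n) : (logn (pr i) k < N)%N.
  by apply: ltn_trans kN; apply: ltn_logl; exact: smooth_gt0 kS.
apply/mapP; exists [ffun i => Ordinal (lt i)]; first by rewrite mem_enum.
rewrite -[LHS](expoK kS); congr idx; apply/ffunP => i.
by rewrite !ffunE.
Qed.

Lemma box_sumE (a : {ffun 'I_n -> nat} -> K) c h N :
  (forall nu, c (idx nu) = a nu) ->
  box_sum a h N = \sum_(k <- box_idx N) c k * mon h k.
Proof.
move=> ca; rewrite big_image /=; apply: eq_bigr => nu _; rewrite ca mon_idx.
by congr (_ * _); apply: eq_bigr => i _; rewrite ffunE.
Qed.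

Lemma seq_tail (S : seq nat) s C a h M : uniq S ->
  (forall k, smooth n k -> (k < M)%N -> k \in S) ->
  small s.+1 h -> wbound (@wt R s) C a ->
  `|\sum_(k <- S) a k * mon h k - psum a h M| * M%:R <= C.
Proof.
move=> uS SM hs aC; pose L := maxn M (\max_(k <- S) k).+1.
have ML : (M <= L)%N by exact: leq_maxl.
have SL : {in S, forall k, (k < L)%N}.
  move=> k kS; apply: leq_trans (leq_maxr _ _); rewrite ltnS.
  exact: leq_bigmax_seq.
rewrite (sum_seq_ord _ uS SL) /psum (@big_ord_widen _ _ _ M L (fun k => a k * mon h k)) //.
rewrite big_mkcond [X in _ - X]big_mkcond -sumrB.
apply: le_trans (aC L); apply: le_trans (ler_wpM2r _ (ler_norm_sum _ _ _)) _ => //.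
rewrite mulr_suml; apply: ler_sum => k _; case: (ltnP k M) => [kM|Mk].
  case: ifPn => [_|kS]; first by rewrite subrr normr0 mul0r mulr_ge0 ?wt_ge0.
  rewrite /mon; case: ifP => [/SM/(_ kM)|_]; first by rewrite (negPf kS).
  by rewrite mulr0 subrr normr0 mul0r mulr_ge0 ?wt_ge0.
rewrite subr0; case: ifP => _; last by rewrite normr0 mul0r mulr_ge0 ?wt_ge0.
by rewrite normrM -mulrA ler_wpM2l // mon_tail.
Qed.

Lemma sum_wbound (S : seq nat) s C a : uniq S -> wbound (@wt R s) C a ->
  \sum_(k <- S) `|a k| * wt R s k <= C.
Proof.
move=> uS aC; pose L := (\max_(k <- S) k).+1.
have SL : {in S, forall k, (k < L)%N} by move=> k kS; rewrite ltnS; exact: leq_bigmax_seq.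
rewrite (sum_seq_ord _ uS SL); apply: le_trans (aC L).
rewrite big_mkcond; apply: ler_sum => k _.
by case: ifP => // _; rewrite mulr_ge0 ?wt_ge0.
Qed.

Definition radius s : K := (\prod_(i < n) pr i)%:R ^- s.+1.

Lemma prod_pr_gt0 : (0 < \prod_(i < n) pr i)%N.
Proof. by apply: prodn_gt0 => i; exact: pr_gt0. Qed.

Lemma radius_gt0 s : 0 < radius s.
Proof. by rewrite invr_gt0 exprn_gt0 // ltr0n prod_pr_gt0. Qed.

Lemma small_radius s h : (forall i, `|h 0 i| <= radius s) -> small s h.
Proof.
move=> hr i; apply: le_trans (hr i) _; rewrite lef_pV2 ?posrE ?exprn_gt0 ?ltr0n ?pr_gt0
  ?prod_pr_gt0 //.
rewrite lerXn2r ?nnegrE // ler_nat (bigD1 i) //= leq_pmulr //.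
by apply: prodn_gt0 => j; exact: pr_gt0.
Qed.

Lemma rep_holomorphic a f : rep x a f -> holomorphic_at x f.
Proof.
move=> [s [C [aC af]]]; have C0 := wbound_ge0 aC.
exists (fun nu => a (idx nu)), (radius s.+1); split; first exact: radius_gt0.
  exists C => N; rewrite (@box_sumE _ (fun k => `|a k|)) //.
  apply: le_trans (sum_wbound (box_idx_uniq N) aC); apply: ler_sum => k _.
  rewrite ler_wpM2l //; apply: le_trans (real_ler_norm _) _.
    rewrite /mon; case: ifP => // _; apply: ger0_real; apply: prodr_ge0 => i _.
    by rewrite mxE exprn_ge0 // ltW // radius_gt0.
  apply: mon_le; apply: small_le (leqnSn s) _; apply: small_radius => i.
  by rewrite mxE ger0_norm // ltW // radius_gt0.
move=> h hr; have hs : small s.+1 h by apply: small_radius => i; rewrite ltW.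
apply/cvgrPdist_lt => e e0; have [|M eM] := complex_archi e0 (_ : 0 <= C + C).
  by rewrite addr_ge0.
exists M.+1 => // N /= MN; have N0 : 0 < N%:R :> K by rewrite ltr0n; apply: leq_trans MN.
rewrite -(ltr_pM2r N0); apply: (@le_lt_trans _ _ (C + C)); last first.
  by apply: lt_le_trans eM _; rewrite ler_pM2l // ler_nat ltnW.
rewrite distrC (@box_sumE _ a) //.
rewrite (_ : _ - _ = (\sum_(k <- box_idx N) a k * mon h k - psum a h N) + (psum a h N - f (x +
  h))); last by ring.
apply: le_trans (ler_wpM2r (ltW N0) (ler_normD _ _)) _; rewrite mulrDl; apply: lerD.
  by apply: seq_tail => //; [exact: box_idx_uniq|move=> k kS kN; exact: mem_box_idx].
by apply: af; exact: small_le hs.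
Qed.

(** If [1 < r * M], all the radii p_i^(-M-1) are below [r], so that weighted sums are bounded by box
    sums at radius [r]. *)
Lemma holomorphic_rep f : holomorphic_at x f -> exists a, rep x a f.
Proof.
move=> [a' [r [r0 [C a'C] cv]]].
have [M rM] := complex_archi r0 (@ler01 K).
have rs i : (pr i)%:R ^- M.+1 < r.
  rewrite -[X in X < _]mul1r ltr_pdivrMr ?exprn_gt0 ?ltr0n ?pr_gt0 //.
  apply: lt_le_trans rM _; rewrite ler_pM2l // -natrX ler_nat.
  apply: (@leq_trans (2 ^ M)); first by rewrite ltnW // ltn_expl.
  rewrite expnS; apply: (@leq_trans (pr i ^ M)); last by rewrite leq_pmull // pr_gt0.
  by case: (M) => // M'; rewrite leq_exp2r // pr_gt1.
pose a k := if smooth n k then a' (expo n k) else 0.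
have aE nu : a (idx nu) = a' nu by rewrite /a smooth_idx idxK.
have aC : wbound (@wt R M) C a.
  move=> N; apply: le_trans (a'C N).
  rewrite (@box_sumE _ (fun k => `|a k|)); last by move=> nu; rewrite aE.
  have mon_ge0 k : 0 <= mon (const_mx r : 'rV[K]_n) k.
    rewrite /mon; case: ifP => // _; apply: prodr_ge0 => i _.
    by rewrite mxE exprn_ge0 // ltW.
  apply: (@le_trans _ _ (\sum_(k <- [seq k <- index_iota 0 N | smooth n k]) `|a k| * mon
    (const_mx r : 'rV[K]_n) k)).
    rewrite big_filter big_mkord [leRHS]big_mkcond; apply: ler_sum => k _.
    rewrite /a; case: ifP => kS; last by rewrite normr0 mul0r.
    rewrite ler_wpM2l // /mon kS -[in leLHS](expoK kS) /wt /idx natr_prod -prodrXl -prodfV.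
    apply: ler_prod => i _; rewrite invr_ge0 exprn_ge0 // ffunE mxE.
    rewrite natrX -exprM mulnC exprM -exprVn lerXn2r ?nnegrE ?invr_ge0 ?exprn_ge0 // ltW //.
  apply: sum_sub_seq => [|||k]; rewrite ?filter_uniq ?iota_uniq ?box_idx_uniq ?mulr_ge0 //.
  move=> k; rewrite mem_filter mem_index_iota => /andP[kS /andP[_ kN]].
  exact: mem_box_idx.
exists a, M.+1, (C + 1); split=> [N|h hs N].
  apply: le_trans (wbound_wt_le (leqnSn M) aC N) _.
  by rewrite lerDl.
have /cvgrPdist_lt cvh : box_sum a' h @ \oo --> f (x + h).
  apply: cv => i; apply: le_lt_trans (rs i); apply: le_trans (hs i) _.
  exact: (@wt_le R M M.+1).
(* Box sums come with no rate of convergence: a box within 1/(N+1) of the limit and containing the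
   smooth indices below [N] is compared with the partial sum, whence the constant [C + 1]. *)
have e0 : 0 < N.+1%:R^-1 :> K by rewrite invr_gt0 ltr0n.
have [N' _ N'P] := cvh _ e0.
pose L := maxn N N'; have := N'P L (leq_maxr _ _).
rewrite (box_sumE _ _ aE) distrC => near_f.
rewrite (_ : _ - _ = - (\sum_(k <- box_idx L) a k * mon h k - psum a h N) +
  (\sum_(k <- box_idx L) a k * mon h k - f (x + h))); last by ring.
apply: le_trans (ler_wpM2r _ (ler_normD _ _)) _ => //; rewrite mulrDl normrN; apply: lerD.
  apply: seq_tail => //; first exact: box_idx_uniq.
  by move=> k kS kN; apply: mem_box_idx => //; apply: leq_trans kN (leq_maxl _ _).
apply: (@le_trans _ _ (N.+1%:R^-1 * N%:R)); first by rewrite ler_wpM2r // ltW.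
by rewrite mulrC ler_pdivrMr // mul1r ler_nat.
Qed.

Lemma near_small (P : 'rV[K]_n -> Prop) :
  (exists s, forall h, small s h -> P (x + h)) -> \forall y \near x, P y.
Proof.
move=> [s sP]; apply/nbhs_ballP; exists (radius s); first exact: radius_gt0.
move=> y xy; have -> : y = x + (y - x) by rewrite addrC subrK.
apply: sP; apply: small_radius => i; rewrite !mxE.
by have := xy.2 0 i; rewrite -ball_normE /= distrC => /ltW.
Qed.

End Holomorphic.

(** * Local rings of germs *)

(** Induction on the number of coordinates. The family [s0] controls all but the last, and the last
    too once it reaches the maximum [m] taken on [s0]; each of the finitely many slices with last
    coordinate below [m] is again handled by induction. *)
Lemma dickson (T : eqType) (c : nat -> T -> nat) n (E : T -> Prop) :
  exists s : seq T, (forall v, v \in s -> E v) /\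
    forall e, E e -> exists2 v, v \in s & forall i, (i < n)%N -> (c i v <= c i e)%N.
Proof.
elim: n E => [|n IH] E.
  have [[e Ee]|nE] := pselect (exists e, E e).
    by exists [:: e]; split=> [v|e' _]; [rewrite inE => /eqP ->|exists e; rewrite ?inE].
  by exists [::]; split=> // e Ee; case: nE; exists e.
have [s0 [s0E s0P]] := IH E.
have /choice[t tP] := fun j => IH (fun e => E e /\ c n e = j).
pose m := \max_(v <- s0) c n v.
exists (s0 ++ flatten [seq t j | j <- iota 0 m]); split=> [v|e Ee].
  rewrite mem_cat => /orP[/s0E //|/flatten_mapP[j _ vt]].
  by have [/(_ v vt)[]] := tP j.
have [em|me] := ltnP (c n e) m.
  have [tE /(_ e (conj Ee erefl))[v vt vP]] := tP (c n e).
  exists v => [|i].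
    rewrite mem_cat; apply/orP; right; apply/flatten_mapP; exists (c n e) => //.
    by rewrite mem_iota.
  rewrite ltnS leq_eqVlt => /predU1P[->|/vP //].
  by have [_ ->] := tE v vt.
have [v vs vP] := s0P e Ee; exists v; first by rewrite mem_cat vs.
move=> i; rewrite ltnS leq_eqVlt => /predU1P[->|/vP //].
by apply: leq_trans me; exact: leq_bigmax_seq.
Qed.

Section HoloDivision.
Local Open Scope classical_set_scope.
Variables (R : realType) (n : nat) (x : 'rV[CC R]_n).
Local Notation K := (CC R).
Implicit Types (f g : holofun x).

Lemma holofunD f g y : (f + g) y = f y + g y. Proof. by []. Qed.
Lemma holofun_sum p (F : 'I_p -> holofun x) y : (\sum_i F i) y = \sum_i F i y.
Proof. by elim/big_rec2: _ => // i u v _ <-. Qed.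

Lemma holofun_rep f : exists a, rep x a f.
Proof. exact: holomorphic_rep (holofunP f). Qed.

Lemma rep_holofun a (f : 'rV[K]_n -> K) : rep x a f ->
  exists g : holofun x, forall y, g y = f y.
Proof. by move=> /rep_holomorphic hf; exists (mk_holofun hf). Qed.

(** Formal division is done at one [s'] that suits [g] and all the tails; its coefficients are then
    summed to functions, and equal coefficients give functions equal near [x]. *)
Lemma holo_division p (F : 'I_p -> holofun x) (a : 'I_p -> nat -> K) (nu : 'I_p -> nat) :
  (forall i, rep x (a i) (F i)) -> (forall i, (0 < nu i)%N) ->
  (forall i, a i (nu i) = 1) -> (forall i k, (k < nu i)%N -> a i k = 0) ->
  forall g, exists (Q : 'I_p -> holofun x) (r : holofun x) c,
    [/\ rep x c r, forall i l, (nu i %| l)%N -> c l = 0 &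
      \forall y \near x, g y = (\sum_i Q i * F i + r) y].
Proof.
move=> aF nu0 lead low g; have [b [sb [Cb [bC bg]]]] := holofun_rep g.
have /choice[s sP] : forall i, exists s, forall s', (s <= s')%N -> forall M,
    \sum_(k < M | (nu i < k)%N) `|a i k| * wt R s' k <= wt R s' (nu i) / 2.
  by move=> i; have [si [Ci [aC _]]] := aF i; exact: tail_small aC (nu0 i).
pose s' := maxn sb (\max_i s i).
have [q [c [D [qD cD c0 bE]]]] := division_coef (wt_gt0 R s') (wt0 R s') (wtM R s')
  nu0 lead low (fun i => sP i s' (leq_trans (leq_bigmax i) (leq_maxr _ _)))
  (wbound_wt_le (leq_maxl _ _) bC).
have /choice[Q QP] : forall i, exists Q : holofun x, rep x (q i) Q.
  move=> i; have [f qf] := rep_exists x (qD i).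
  by have [h /funext hf] := rep_holofun qf; exists h; rewrite hf.
have [f cf] := rep_exists x cD; have [r /funext rf] := rep_holofun cf.
exists Q, r, c; split=> //; first by rewrite rf.
apply: near_small.
have rb : rep x (fun k => 1 * (\sum_i conv (q i) (a i) k) + c k)
   (fun y => 1 * (\sum_i (Q i y * F i y)) + r y).
  apply: rep_linear; last by rewrite rf.
  by apply: rep_sum => i; apply: rep_conv.
have [t tP] := rep_unique (fun k kS => etrans (bE k (smooth_gt0 kS))
    (congr1 (fun z => z + c k) (esym (mul1r _)))) (ex_intro _ sb (ex_intro _ Cb (conj bC bg))) rb.
exists t => h /tP ->; rewrite mul1r holofunD holofun_sum.
by [].
Qed.

End HoloDivision.

Section LocalRings.
Local Open Scope classical_set_scope.
Variables (R : realType) (n : nat) (X : germ R n).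
Local Notation K := (CC R).
Local Notation x := (base X).
Implicit Types (f g : holofun (base X)).

Lemma germ_ofD f g : germ_of X (f + g) = germ_of X f + germ_of X g.
Proof. by rewrite /germ_of rmorphD. Qed.

Lemma germ_ofM f g : germ_of X (f * g) = germ_of X f * germ_of X g.
Proof. by rewrite /germ_of rmorphM. Qed.

Lemma germ_of_near f g : (\forall y \near x, f y = g y) -> germ_of X f = germ_of X g.
Proof. by move=> fg; apply/germ_ofP; apply: filterS fg => y ->. Qed.

Lemma rep_scale (z : K) a f : rep x a f -> exists2 g : holofun x,
  rep x (fun k => z * a k) g & germ_of X g = cst_germ X z * germ_of X f.
Proof.
move=> af; have := rep_linear z af (rep0 x).
have -> : (fun k => z * a k + 0) = (fun k => z * a k) by apply/funext => k; rewrite addr0.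
move=> /[dup] /rep_holofun[g gE] zf; exists g; first by rewrite (funext gE).
rewrite /cst_germ -germ_ofM; apply: germ_of_near; apply: filterE => y.
by rewrite gE addr0.
Qed.

Lemma rep_germ0 c f : rep x c f -> (forall k, smooth n k -> c k = 0) -> germ_of X f = 0.
Proof.
move=> cf c0; have <- : germ_of X 0 = 0 by rewrite /germ_of rmorph0.
by apply: germ_of_near; apply: near_small; exact: (rep_unique c0 cf (rep0 x)).
Qed.

(** If [f] does not vanish at the base point, [f] divided by its value there has initial monomial 1,
    once the coefficient at index 0 is erased. Every index is a multiple of 1, so dividing the
    function 1 leaves no remainder. *)
Lemma local_ring_local : is_local (residue X).
Proof.
move=> u; rewrite -[u]germ_of_repr; move: (repr u) => f.
rewrite [residue X _]residue_germ_of => fx; have [a af] := holofun_rep f.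
have := rep_smooth af; set a' := fun k => _; move=> a'f.
have a'1 : a' 1%N = f x by rewrite /a' smooth1 (rep_base af).
have [g ag gE] := rep_scale (f x)^-1 a'f.
have [||||Q [r [c [cr c0 E]]]] := @holo_division _ _ x 1 (fun=> g)
    (fun _ k => (f x)^-1 * a' k) (fun=> 1%N) _ _ _ _ 1.
- by [].
- by [].
- by move=> _; rewrite a'1 mulVf.
- by move=> _ [|//] _; rewrite /a' mulr0.
have r0 : germ_of X r = 0 by apply: rep_germ0 cr _ => k _; exact: (c0 ord0).
exists (cst_germ X (f x)^-1 * germ_of X (Q ord0)).
have <- : germ_of X 1 = 1 by rewrite /germ_of rmorph1.
by rewrite (germ_of_near E) big_ord1 germ_ofD r0 addr0 germ_ofM gE mulrCA [RHS]mulrCA (mulrC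
  (germ_of X f)).
Qed.

(** If the remainder of a member of [S] by the [F i] had a nonzero coefficient at a monomial, its
    first such index would belong to [E], hence be a multiple of some [nu i], where the remainder
    has no coefficient. *)
Lemma local_ring_noetherian : noetherian (local_ring X).
Proof.
move=> S sS; have [S0 SD] := sS.
have SM (u v : local_ring X) : S v -> S (u * v).
  by move=> Sv; have := SD u v 0 Sv S0; rewrite addr0.
pose lead f k := smooth n k /\ exists a, [/\ rep x a f, a k = 1 & forall j, (j < k)%N -> a j = 0].
(* Functions vanishing on [X] have germ 0 and count here: the ideal to be divided is the inverse
   image of [S] among the holomorphic functions. *)
pose E k := exists f, S (germ_of X f) /\ lead f k.
have [s [sE sP]] := dickson (fun i => logn (pr i)) n E.
pose p := size s; pose nu (i : 'I_p) := nth 0%N s i.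
have nuE i : E (nu i) by apply: sE; rewrite mem_nth.
have /choice[F FP] := nuE.
have /choice[a aP] := fun i => (FP i).2.2.
apply/(fin_genP sS); exists p, (fun i => germ_of X (F i)); split=> [i|u Su].
  by case: (FP i).
have [|i|i|i|Q [r [c [cr c0 gE]]]] := @holo_division _ _ x p F a nu _ _ _ _ (repr u).
- by move=> i; case: (aP i).
- by apply: (@smooth_gt0 n); case: (FP i) => _ [].
- by case: (aP i).
- by move=> k; case: (aP i) => _ _; apply.
have uE : u = \sum_i germ_of X (Q i) * germ_of X (F i) + germ_of X r.
  rewrite -[LHS]germ_of_repr (germ_of_near gE) germ_ofD; congr (_ + _).
  by rewrite /germ_of rmorph_sum; apply: eq_bigr => i _; rewrite rmorphM.
have Sr : S (germ_of X r).
  have -> : germ_of X r = -1 * (\sum_i germ_of X (Q i) * germ_of X (F i)) + u.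
    by rewrite uE mulN1r addrA addNr add0r.
  apply: (SD) => //; elim/big_ind: _ => // [v w Sv Sw|i _].
    by have := SD 1 v w Sv Sw; rewrite scale1r.
  by apply: SM; case: (FP i).
suff r0 : germ_of X r = 0.
  by exists (fun i => germ_of X (Q i)); rewrite uE r0 addr0.
apply: rep_germ0 (cr) _ => k kS; apply: contrapT => ck.
pose P k := `[< smooth n k /\ c k <> 0 >].
have exP : exists k, P k by exists k; apply/asboolP.
case: (ex_minnP exP) => {k kS ck exP} k /asboolP[kS ck] kmin.
have [g cg gE'] := rep_scale (c k)^-1 (rep_smooth cr).
have : E k.
  exists g; split; first by rewrite gE'; exact: SM.
  split=> //; exists (fun j => (c k)^-1 * (if smooth n j then c j else 0)); split=> // [|j jk].
    by rewrite kS mulVf //; exact/eqP.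
  case: ifP => jS; last by rewrite mulr0.
  have -> : c j = 0; last by rewrite mulr0.
  apply: contrapT => cj; have /kmin : P j by apply/asboolP.
  by rewrite leqNgt jk.
move=> /sP[v vs vk]; apply: ck.
have vp : (index v s < p)%N by rewrite index_mem.
have nuv : nu (Ordinal vp) = v by rewrite /nu /= nth_index.
apply: (c0 (Ordinal vp)); rewrite nuv.
have [_ [_ [vS _]]] := sE v vs.
by apply: (smooth_dvdn vS); first exact: smooth_gt0 kS.
Qed.

End LocalRings.

(** Equality of germs is pointwise equality on [X] near the base point, and the complex numbers have
    no nilpotents. *)
Lemma local_ring_reduced (R : realType) n (X : germ R n) (u : local_ring X) p :
  u ^+ p = 0 -> u = 0.
Proof.
rewrite -[u]germ_of_repr; move: (repr u) => f.
have -> : germ_of X f ^+ p = germ_of X (f ^+ p) by rewrite /germ_of rmorphXn.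
have <- : germ_of X 0 = 0 by rewrite /germ_of rmorph0.
have powE y : (f ^+ p : holofun _) y = f y ^+ p.
  elim: p => [|p IH]; first by rewrite !expr0.
  by rewrite !exprS -IH.
move=> /germ_ofP h; apply/germ_ofP; apply: filterS h => y h Xy.
apply/eqP; have := h Xy; rewrite powE => /eqP; rewrite expf_eq0 => /andP[_ /eqP ->].
exact: eqxx.
Qed.

Lemma residue_pullback (R : realType) l n (Z : germ R l) (X : germ R n)
  (alpha : germ_morphism Z X) s : residue Z (pullback alpha s) = residue X s.
Proof.
have [f [g [-> gE fg]]] := pullbackE alpha s.
rewrite [pullback alpha _]gE ![residue _ _]residue_germ_of.
by rewrite -(nbhs_singleton fg (base_locus Z)) mor_base.
Qed.

(** In case (a) the surjection is a morphism of algebras over the complex numbers, compatible with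
    the maps to the local ring of [Z]; this compatibility is what yields a section of [pi2]. *)
Theorem corollary3p15 (R : realType) (n m l : nat)
  (X : germ R n) (Y : germ R m) (Z : germ R l)
  (alpha : germ_morphism Z X) (beta : germ_morphism Z Y)
  (alpha_surj : forall u : local_ring Z, exists s, pullback alpha s = u)
  (beta_surj : forall u : local_ring Z, exists t, pullback beta t = u)
  (alpha_niso : ~ bijective (pullback alpha))
  (beta_niso : ~ bijective (pullback beta))
  (W : idealr (local_ring Y)) (W_radical : radical_ideal W)
  (large_hyp :
    (weakly_large_gluing alpha beta /\
     exists gamma : {rmorphism local_ring Y -> local_ring X},
       [/\ forall s, exists t, gamma t = s,
           forall c, gamma (cst_germ Y c) = cst_germ X c &
           forall t, pullback alpha (gamma t) = pullback beta t])
    \/ strongly_large_gluing alpha beta) :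
  [/\ glue_betti alpha beta W 0 = betti_subspace W 0,
      glue_betti alpha beta W 1 =
        (betti_subspace W 0 * betti_along alpha 1 + betti_subspace W 1)%N &
      glue_betti alpha beta W 2 =
        (betti_subspace W 0 * betti_along beta 1 * betti_along alpha 1
         + betti_subspace W 0 * betti_along alpha 2
         + betti_subspace W 1 * betti_along alpha 1
         + betti_subspace W 2)%N].
Proof.
apply: (betti_fiber (rhoA := residue X) alpha_surj beta_surj) => //.
- move=> s t st; rewrite -(residue_pullback alpha) st; exact: residue_pullback.
- exact: local_ring_noetherian.
- exact: local_ring_noetherian.
- exact: local_ring_local.
- exact: local_ring_local.
- exact: local_ring_reduced.
- by case: large_hyp => [[weak [gamma [_ _ gE]]]|]; [left; split=> //; exists gamma|right].
Qed.
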